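(* Let $d\in\{1,2,3\}$, let $\mathcal D=[0,1]^d$, and let $\vec X:\mathcal D\to\Omega$ and $\vec X^e:\mathcal D\to\Omega_e$ be smooth bijective mappings onto domains $\Omega,\Omega_e\subset\mathbb R^d$, with Jacobian determinants $J$ and $J_e$ satisfying $J_{max}\ge J\ge J_{min}>0$ and $J_{e,max}\ge J_e\ge J_{e,min}>0$ on $\mathcal D$ for some constants. Then there is a constant $C>0$, depending only on $J$ and $J_e$ (not on the solutions, the data, or $t$), such that the following holds. Let $A_1,\dots,A_d$ be constant real symmetric $N_{eq}\times N_{eq}$ matrices. Let the initial data $\mathbf q_0$, boundary data $\mathbf g$, reflection operators $R$, $R_e$, and boundary splitting $\partial\mathcal D=\partial\mathcal D_g\cup\partial\mathcal D_r$ be as in the context. If $\mathbf q$ is a smooth solution of the correct problem and $\mathbf v$ is a smooth solution of the erroneous problem (both described in the context), then for all $t\ge 0$ in the common interval of existence the error $\mathbf v-\mathbf q$ is bounded by data: $$\|\mathbf v(t)-\mathbf q(t)\|_J\;\le\; C\left(\mathcal K_e(t)^{1/2}+\mathcal K(t)^{1/2}\right),$$ where $$\mathcal K(t)=\big\|\mathbf q_0(\vec X(\cdot))\big\|_J^2+\int_0^t\int_{\partial\mathcal D_g}\mathbf g^T(\vec X(\vec\xi),s)\,|A^-|\,\mathbf g(\vec X(\vec\xi),s)\,\mathrm dS\,\mathrm ds,$$ $$\mathcal K_e(t)=\big\|\mathbf q_0(\vec X^e(\cdot))\big\|_{J_e}^2+\int_0^t\int_{\partial\mathcal D_g}\mathbf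 g^T(\vec X^e(\vec\xi),s)\,|A_e^-|\,\mathbf g(\vec X^e(\vec\xi),s)\,\mathrm dS\,\mathrm ds.$$
   Context: **Norms.** For a positive weight $w$ on $\mathcal D$ and $\mathbf u:\mathcal D\to\mathbb R^{N_{eq}}$, $\|\mathbf u\|_w=\left(\int_{\mathcal D} w\,\mathbf u^T\mathbf u\,d\vec\xi\right)^{1/2}$. The solutions $\mathbf q(\vec\xi,t)$ and $\mathbf v(\vec\xi,t)$ are regarded as functions on the reference domain $\mathcal D$, and the error $\mathbf v-\mathbf q$ is measured there. Solutions are smooth (continuously differentiable up to the boundary of $\mathcal D$ and up to $t=0$). **Metric terms.** For the mapping $\vec x=\vec X(\vec\xi)$, $J\vec a^i$ denotes the volume weighted contravariant basis vectors, $J\vec a^i=J\nabla_x\xi^i$; for $d=3$ these are $J\vec a^i=\vec a_j\times\vec a_k$ with $(i,j,k)$ cyclic and $\vec a_i=\partial\vec X/\partial\xi^i$, and $J=\vec a_i\cdot(\vec a_j\times\vec a_k)$. The metric identities $\sum_{i}\partial_{\xi^i}(Ja^i_n)=0$, $n=1,\dots,d$, hold. The quantities $J_e\vec a^i_e$ are defined in the same way from $\vec X^e$, and also satisfy the metric identities. **Contravariant coefficient matrices.** $\tilde A^i=\sum_{n=1}^d (Ja^i_n)A_n$ and $\tilde A_e^i=\sum_{n=1}^d (J_ea^i_{e,n})A_n$. **Equations.** The underlying system is $\mathbf q_t+\sum_i\partial_{x_i}(A_i\mathbf q)=0$. On $\mathcal D$ the correct problem is $J\mathbf q_t+\sum_i\partial_{\xi^i}(\tilde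 A^i\mathbf q)=0$ with $\mathbf q(\vec\xi,0)=\mathbf q_0(\vec X(\vec\xi))$. The erroneous problem is $J_e\mathbf v_t+\sum_i\partial_{\xi^i}(\tilde A_e^i\mathbf v)=0$ with $\mathbf v(\vec\xi,0)=\mathbf q_0(\vec X^e(\vec\xi))$. **Normal matrices.** On $\partial\mathcal D$ with outward unit normal $\hat n$, set $A=\sum_i\tilde A^i\hat n_i$ and $A_e=\sum_i\tilde A_e^i\hat n_i$. These are symmetric; write $A=P\Lambda P^T$ with $P$ orthogonal, with the positive eigenvalues listed first and then the negative ones (zero eigenvalues are assumed absent). Put $A^\pm=\tfrac12(A\pm|A|)=P\Lambda^\pm P^T$, where $\Lambda^+=\mathrm{diag}(\bar\Lambda^+,0)$ and $\Lambda^-=\mathrm{diag}(0,\bar\Lambda^-)$, and $|A^-|=-A^-$. The quantities $P_e,\Lambda_e,\Lambda_e^\pm,A_e^\pm$ are defined in the same way from $A_e$. **Boundary conditions.** The boundary is split into two parts, $\partial\mathcal D=\partial\mathcal D_g\cup\partial\mathcal D_r$, with the same splitting for both problems. - On $\partial\mathcal D_g$ the incoming characteristic variables are specified by external data: $A^-\mathbf q=A^-\mathbf g(\vec X(\vec\xi),t)$ for the correct problem, and $A_e^-\mathbf v=A_e^-\mathbf g(\vec X^e(\vec\xi),t)$ for the erroneous problem. - On $\partial\mathcal D_r$ reflection conditions are imposed. For the correct problem, with $\mathbf w=P^T\mathbf q=(\mathbf w^+,\mathbf w^-)$ split according to the positive and negative eigenvalues, $\mathbf w^-=\bar R\,\mathbf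 w^+$. Setting $R=\begin{pmatrix} I&0\\ \bar R&0\end{pmatrix}$, it is required that $\Lambda^++R^T\Lambda^-R\ge0$ (positive semidefinite). For the erroneous problem the same form of condition holds with $P_e$, $\bar R_e$ and $R_e=\begin{pmatrix} I&0\\ \bar R_e&0\end{pmatrix}$, where $\Lambda_e^++R_e^T\Lambda_e^-R_e\ge0$. **Data.** $\mathbf q_0$ is defined on both $\Omega$ and $\Omega_e$. The boundary data $\mathbf g(\vec x,t)$ is defined on the images of $\partial\mathcal D_g$ under both $\vec X$ and $\vec X^e$. All data have continuous and bounded first derivatives. *)

(* Defs.v *)
From HB Require Import structures.
From mathcomp Require Import all_boot all_order all_algebra.
From mathcomp Require Import ring.
From mathcomp Require Import all_classical all_reals all_analysis.

Set Implicit Arguments.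
Unset Strict Implicit.
Unset Printing Implicit Defensive.

Import Order.TTheory GRing.Theory Num.Theory.
Import numFieldNormedType.Exports.

Local Open Scope classical_set_scope.
Local Open Scope ring_scope.

(* Points of R^d are row vectors, states are
   column vectors. *)

Section Calculus.
Variable R : realType.

(* Derivative of f at x relative to E: the difference quotient only sees the
   points of E. It is the usual derivative inside an interval E and the
   one-sided derivative at an end point that belongs to E, whereas the
   library's derivatives would depend on the values of f outside E. *)
Definition rel_quotient (E : set R) (f : R -> R) (x : R) :=
  (fun y : R => (f y - f x) / (y - x)) @ within E x^'.

Definition rel_derivable (E : set R) (f : R -> R) (x : R) : Prop :=
  cvg (rel_quotient E f x).

Definition rel_derive (E : set R) (f : R -> R) (x : R) : R :=
  lim (rel_quotient E f x).

Variable d : nat.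

Definition unit_cube : set 'rV[R]_d :=
  [set xi | forall i, 0 <= xi 0 i <= 1].

Definition cube_boundary : set 'rV[R]_d :=
  [set xi | unit_cube xi /\ exists i, xi 0 i = 0 \/ xi 0 i = 1].

(* The boundary without the points lying on two faces, which have no normal
   vector and form a null set for dS. *)
Definition regular_boundary : set 'rV[R]_d :=
  [set xi | exists i, (xi 0 i = 0 \/ xi 0 i = 1) /\
                      forall j, j != i -> 0 < xi 0 j < 1].

Definition outward_normal (xi : 'rV[R]_d) : 'rV[R]_d :=
  \row_i ((xi 0 i == 1)%:R - (xi 0 i == 0)%:R).

Definition set_coord (xi : 'rV[R]_d) (i : 'I_d) (s : R) : 'rV[R]_d :=
  \row_j (if j == i then s else xi 0 j).

(* Partial derivatives on the closed cube, one-sided on the faces. *)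
Definition pderivable (f : 'rV[R]_d -> R) (i : 'I_d) (xi : 'rV[R]_d) : Prop :=
  rel_derivable `[0, 1] (fun s => f (set_coord xi i s)) (xi 0 i).

Definition pderiv (f : 'rV[R]_d -> R) (i : 'I_d) (xi : 'rV[R]_d) : R :=
  rel_derive `[0, 1] (fun s => f (set_coord xi i s)) (xi 0 i).

(* k times continuously differentiable on the cube, up to its boundary. *)
Fixpoint Ck (k : nat) (f : 'rV[R]_d -> R) : Prop :=
  {within unit_cube, continuous f} /\
  (if k is k'.+1 then
     forall i, (forall xi, unit_cube xi -> pderivable f i xi) /\
               Ck k' (pderiv f i)
   else True).

(* Continuously differentiable in space and time on unit_cube x I. *)
Definition C1_spacetime (I : set R) (f : 'rV[R]_d -> R -> R) : Prop :=
  [/\ {within unit_cube `*` I, continuous (fun z => f z.1 z.2)},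
      (forall i xi t, unit_cube xi -> I t ->
          pderivable (fun z => f z t) i xi),
      (forall i, {within unit_cube `*` I,
          continuous (fun z => pderiv (fun x => f x z.2) i z.1)}),
      (forall xi t, unit_cube xi -> I t -> rel_derivable I (f xi) t) &
      {within unit_cube `*` I,
          continuous (fun z => rel_derive I (f z.1) z.2)}].

(* f, whose values matter on S only, has continuous and bounded first
   derivatives on S; as S may be closed or contained in a hypersurface, this
   is expressed through an extension to an open neighbourhood of S. *)
Definition C1_bounded_on (V W : normedModType R) (S : set V) (f : V -> W) :
    Prop :=
  exists (U : set V) (F : V -> W),
    [/\ open U /\ S `<=` U,
        (forall x, S x -> F x = f x),
        (forall x, U x -> differentiable F x),
        (forall v x, U x -> {for x, continuous (fun y => 'D_v F y)}) &
        exists M : R, forall x, S x -> forall v, `|'D_v F x| <= M * `|v|].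

(* Lebesgue integral over the coordinates listed in s, each in ]0, 1[; the
   other coordinates are those of xi. *)
Fixpoint iter_int (s : seq 'I_d) (f : 'rV[R]_d -> R) (xi : 'rV[R]_d) : R :=
  if s is i :: s' then
    \int[lebesgue_measure]_(x in `]0, 1[) iter_int s' f (set_coord xi i x)
  else f xi.

Definition cube_int (f : 'rV[R]_d -> R) : R := iter_int (enum 'I_d) f 0.

(* Integral over the part S of the boundary: sum over the 2d open faces
   xi_i = b. For d = 1, a face is a point and dS is the counting measure. *)
Definition surface_int (S : set 'rV[R]_d) (f : 'rV[R]_d -> R) : R :=
  \sum_(i < d) \sum_(b : bool)
    iter_int [seq j <- enum 'I_d | j != i] (fun xi => \1_S xi * f xi)
             (set_coord 0 i b%:R).

Definition borel_set (S : set 'rV[R]_d) : Prop :=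
  <<s [set U : set 'rV[R]_d | open U] >> S.

Definition time_interval (I : set R) : Prop :=
  [/\ is_interval I, I 0, (forall t, I t -> 0 <= t) & exists2 t, I t & 0 < t].

End Calculus.

Section Geometry.
Variables (R : realType) (d : nat).
Implicit Types (X : 'rV[R]_d -> 'rV[R]_d) (xi : 'rV[R]_d).

(* Column i is the covariant basis vector a_i = d X / d xi^i. *)
Definition jacobian X xi : 'M[R]_d :=
  \matrix_(n, i) pderiv (fun z => X z 0 n) i xi.

(* Row i is J a^i = J grad_x xi^i: the Jacobian matrix d xi / d x of the
   inverse map is the inverse of d X / d xi. *)
Definition contravariant X xi : 'M[R]_d :=
  \det (jacobian X xi) *: invmx (jacobian X xi).

(* A C^2 bijection of the cube onto Omega with Jacobian determinant J. The
   metric terms are then C^1, and the metric identities hold. *)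
Definition smooth_mapping X (Omega : set 'rV[R]_d) (J : 'rV[R]_d -> R) : Prop :=
  [/\ set_bij (@unit_cube R d) Omega X,
      (forall n, Ck 2 (fun xi => X xi 0 n)) &
      forall xi, unit_cube xi -> \det (jacobian X xi) = J xi].

Definition bounded_positive (J : 'rV[R]_d -> R) : Prop :=
  exists Jmin Jmax : R,
    0 < Jmin /\ forall xi, unit_cube xi -> Jmin <= J xi <= Jmax.

End Geometry.

(* For d = 3 and (i, j, k) cyclic, J a^i = a_j x a_k; the component n of the
   cross product is written with (n, n + 1, n + 2) cyclic. *)
Lemma contravariant_cross (R : realType) (X : 'rV[R]_3 -> 'rV[R]_3)
    (xi : 'rV[R]_3) (i n : 'I_3) :
  let G := jacobian X xi in
  \det G != 0 ->
  contravariant X xi i n =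
    G (n + 1) (i + 1) * G (n + 2%:R) (i + 2%:R)
    - G (n + 2%:R) (i + 1) * G (n + 1) (i + 2%:R).
Proof.
rewrite /contravariant /=; move: (jacobian X xi) => G Gn0.
have -> : \det G *: invmx G = \adj G.
  by rewrite /invmx unitmxE unitfE Gn0 scalerA divff ?scale1r.
rewrite mxE /cofactor (expand_det_row _ ord0) !big_ord_recl big_ord0.
rewrite /cofactor !det_mx11 !mxE.
pose g (a b : nat) := G (inord a) (inord b).
have gE a b : G a b = g a b by rewrite /g !inord_val.
rewrite !gE.
by case: i => [[|[|[|//]]] ?]; case: n => [[|[|[|//]]] ?]; rewrite /= /bump /=;
  ring.
Qed.

Section System.
Variables (R : realType) (d N : nat).
Implicit Types (X : 'rV[R]_d -> 'rV[R]_d) (A : 'I_d -> 'M[R]_N).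
Implicit Types (xi : 'rV[R]_d) (P Rbar : 'M[R]_N) (lam : 'rV[R]_N).

(* \tilde A^i = \sum_n (J a^i_n) A_n *)
Definition contra_coef X A xi (i : 'I_d) : 'M[R]_N :=
  \sum_(n < d) contravariant X xi i n *: A n.

Definition normal_mx X A xi : 'M[R]_N :=
  \sum_(i < d) outward_normal xi 0 i *: contra_coef X A xi i.

(* M = P diag(lam) P^T with P orthogonal, no zero eigenvalue, and the positive
   eigenvalues listed before the negative ones. *)
Definition sorted_eigen (M P : 'M[R]_N) lam : Prop :=
  [/\ P^T *m P = 1%:M, M = P *m diag_mx lam *m P^T,
      (forall i, lam 0 i != 0) &
      forall i j : 'I_N, (i <= j)%N -> 0 < lam 0 j -> 0 < lam 0 i].

Definition lam_plus lam : 'M[R]_N := diag_mx (map_mx (Num.max 0) lam).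
Definition lam_minus lam : 'M[R]_N := diag_mx (map_mx (Num.min 0) lam).

Definition mx_minus P lam : 'M[R]_N := P *m lam_minus lam *m P^T.
Definition abs_mx_minus P lam : 'M[R]_N := - mx_minus P lam.

(* \bar R is stored in the entries (i, j) of the N x N matrix Rbar with
   lam_i < 0 < lam_j; the other entries of Rbar are ignored. *)
Definition reflection_mx lam Rbar : 'M[R]_N :=
  \matrix_(i, j) (if 0 < lam 0 i then (i == j)%:R
                  else if 0 < lam 0 j then Rbar i j else 0).

(* w^- = \bar R w^+ *)
Definition reflection_condition lam Rbar (w : 'cV[R]_N) : Prop :=
  forall i, lam 0 i < 0 -> w i 0 = \sum_(j < N | 0 < lam 0 j) Rbar i j * w j 0.

Definition psd_mx (M : 'M[R]_N) : Prop :=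
  M^T = M /\ forall z : 'cV[R]_N, 0 <= (z^T *m M *m z) 0 0.

Definition dissipative_reflection lam Rbar : Prop :=
  let Rm := reflection_mx lam Rbar in
  psd_mx (lam_plus lam + Rm^T *m lam_minus lam *m Rm).

(* On the part Dg of the boundary (resp. Dr), the conditions are imposed where
   the normal vector is defined. J is the Jacobian determinant of X. *)
Definition smooth_solution (J : 'rV[R]_d -> R) X A
    (q0 : 'rV[R]_d -> 'cV[R]_N) (g : 'rV[R]_d -> R -> 'cV[R]_N)
    (Dg Dr : set 'rV[R]_d)
    (P : 'rV[R]_d -> 'M[R]_N) (lam : 'rV[R]_d -> 'rV[R]_N)
    (Rbar : 'rV[R]_d -> 'M[R]_N)
    (I : set R) (q : 'rV[R]_d -> R -> 'cV[R]_N) : Prop :=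
  [/\ (forall k, C1_spacetime I (fun xi t => q xi t k 0)),
      (forall xi t k, unit_cube xi -> I t ->
         J xi * rel_derive I (fun s => q xi s k 0) t
         + \sum_(i < d)
             pderiv (fun z => (contra_coef X A z i *m q z t) k 0) i xi = 0),
      (forall xi, unit_cube xi -> q xi 0 = q0 (X xi)),
      (forall xi t, Dg xi -> regular_boundary xi -> I t ->
         mx_minus (P xi) (lam xi) *m q xi t
         = mx_minus (P xi) (lam xi) *m g (X xi) t) &
      (forall xi t, Dr xi -> regular_boundary xi -> I t ->
         reflection_condition (lam xi) (Rbar xi) ((P xi)^T *m q xi t))].

Definition weighted_norm (w : 'rV[R]_d -> R) (u : 'rV[R]_d -> 'cV[R]_N) : R :=
  Num.sqrt (cube_int (fun xi => w xi * ((u xi)^T *m u xi) 0 0)).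

Definition data_bound (J : 'rV[R]_d -> R) X
    (q0 : 'rV[R]_d -> 'cV[R]_N) (g : 'rV[R]_d -> R -> 'cV[R]_N)
    (Dg : set 'rV[R]_d)
    (P : 'rV[R]_d -> 'M[R]_N) (lam : 'rV[R]_d -> 'rV[R]_N) (t : R) : R :=
  weighted_norm J (fun xi => q0 (X xi)) ^+ 2
  + \int[lebesgue_measure]_(s in `[0, t])
      surface_int Dg (fun xi =>
        ((g (X xi) s)^T *m abs_mx_minus (P xi) (lam xi) *m g (X xi) s) 0 0).

End System.

(* Main.v *)
Require Import Defs.
From HB Require Import structures.
From mathcomp Require Import all_boot all_order all_algebra.
From mathcomp Require Import perm ring lra.
From mathcomp Require Import all_classical all_reals all_analysis.

(** The error is bounded because each of the two solutions is bounded by its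
    own data. Since |v - q|^2 <= 2 |v|^2 + 2 |q|^2 and J <= c Je for a constant
    c obtained from the bounds on J and Je, the estimate follows from the energy
    inequality ||q(t)||_J^2 <= K(t) ([energy_estimate]) applied to q with J and
    to v with Je, with C = (2 c)^(1/2).

    The energy inequality comes from multiplying the equation by 2 q^T. The
    coefficient matrices are symmetric, and their divergence vanishes by the
    metric identities ([sum_contra_coef_deriv]), so that
      d/dt (J |q|^2) + sum_i d/dxi^i (q^T A~^i q) = 0
    ([conservation]). Integrating over the cube and over [0, t] leaves the
    energy entering through the faces, - q^T A q integrated over the boundary
    ([energy_balance]). At every regular boundary point this is at most the
    corresponding data term ([influx_le_data]): on the data part, because
    A^- q = A^- g and A^+ >= 0; on the reflecting part, because q^T A q is the
    value of the positive semidefinite form Lambda^+ + R^T Lambda^- R.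

    The metric identities are the Piola identity: the entries of the adjugate
    of a Jacobian matrix are its determinants with one row replaced by a basis
    vector; differentiating another row produces second derivatives, symmetric
    in two indices in which these determinants are alternating
    ([sum_cofactor_deriv]). The symmetry of second derivatives up to the
    boundary is deduced from the exchange of the order of integration
    ([pderiv_comm]).

    Two devices keep the analysis elementary. Functions that are continuous on
    the closed cube (and on a time interval) are composed with the retraction
    onto it, which makes them continuous on the whole space and leaves their
    integrals unchanged; all the theorems on iterated integrals are then needed
    for globally continuous integrands only. The boundary data term has no
    evident measurability, since it involves g, the boundary partition and a
    pointwise choice of eigenvectors; but it lies between two continuous
    functions, and the integral of a nonnegative function is a supremum over
    simple functions, hence monotone without measurability
    ([Rintegral_le_bounded]). *)

Set Implicit Arguments.
Unset Strict Implicit.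
Unset Printing Implicit Defensive.

Import Order.TTheory GRing.Theory Num.Theory.
Import numFieldNormedType.Exports.

Local Open Scope classical_set_scope.
Local Open Scope ring_scope.

(** * Integrals over intervals *)

Section DominatedMonotonicity.
Context d (T : measurableType d) (R : realType).
Variable mu : {measure set T -> \bar R}.

(** The integral of a nonnegative function is the supremum of the integrals of
    the simple functions below it, which makes it monotone for arbitrary f and
    g. The bound M keeps the integrals finite: [Rintegral] sends +oo to 0. *)
Lemma Rintegral_le_bounded (D : set T) (f g M : T -> R) : measurable D ->
  (forall x, D x -> 0 <= f x <= g x) -> (forall x, D x -> g x <= M x) ->
  mu.-integrable D (EFin \o M) ->
  \int[mu]_(x in D) f x <= \int[mu]_(x in D) g x <= \int[mu]_(x in D) M x.
Proof.
move=> mD fg gM iM.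
have mono (h k : T -> R) : (forall x, D x -> 0 <= h x <= k x) ->
    (\int[mu]_(x in D) (h x)%:E <= \int[mu]_(x in D) (k x)%:E)%E.
  move=> hk; rewrite !(integral_mkcond D) !ge0_integralTE.
  - apply: le_ereal_sup => _ [s sh <-]; exists s => // x.
    apply: (le_trans (sh x)); rewrite !patchE; case: ifPn => // /set_mem /hk.
    by rewrite lee_fin => /andP[].
  - by apply: erestrict_ge0 => x /hk/andP[h0 hkx]; rewrite lee_fin (le_trans h0).
  - by apply: erestrict_ge0 => x /hk/andP[]; rewrite lee_fin.
have finM := integrable_fin_num mD iM.
have le_fg := mono _ _ fg.
have gM' x : D x -> 0 <= g x <= M x.
  by move=> Dx; rewrite gM // andbT; have /andP[f0 /(le_trans f0)] := fg x Dx.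
have le_gM := mono _ _ gM'.
have fin0 (h k : T -> R) : (forall x, D x -> 0 <= h x) ->
    (\int[mu]_(x in D) (h x)%:E <= \int[mu]_(x in D) (k x)%:E)%E ->
    (\int[mu]_(x in D) (k x)%:E)%E \is a fin_num ->
    (\int[mu]_(x in D) (h x)%:E)%E \is a fin_num.
  move=> h0 hk fk; rewrite ge0_fin_numE; last exact: integral_ge0.
  by apply: le_lt_trans hk _; rewrite ltey_eq fk.
have fing := fin0 _ _ (fun x Dx => proj1 (andP (gM' x Dx))) le_gM finM.
have finf := fin0 _ _ (fun x Dx => proj1 (andP (fg x Dx))) le_fg fing.
by rewrite /Rintegral !fine_le.
Qed.

End DominatedMonotonicity.

Section IntervalIntegrals.
Variable R : realType.
Notation mu := (@lebesgue_measure R).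
Implicit Types (f g M : R -> R) (a b : R).

Lemma continuous_integrable_cc f a b : continuous f ->
  mu.-integrable `[a, b] (EFin \o f).
Proof.
move=> cf; apply: continuous_compact_integrable; first exact: segment_compact.
exact: continuous_subspaceT.
Qed.

Lemma continuous_integrable_oo f a b : continuous f ->
  mu.-integrable `]a, b[ (EFin \o f).
Proof.
move=> cf; apply: (integrableS _ _ _ (continuous_integrable_cc a b cf)) => //.
exact: subset_itv_oo_cc.
Qed.

Lemma Rintegral_oo_cc f a b : continuous f ->
  \int[mu]_(x in `]a, b[) f x = \int[mu]_(x in `[a, b]) f x.
Proof.
move=> cf; rewrite Rintegral_itv_bndo_bndc; last exact: continuous_integrable_oo.
apply: Rintegral_itv_obnd_cbnd.
apply: (integrableS _ _ _ (continuous_integrable_cc a b cf)) => //.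
exact: subset_itv_oc_cc.
Qed.

Lemma continuous_pair (S T U : topologicalType) (f : S -> T) (h : S -> U) :
  continuous f -> continuous h -> continuous (fun z => (f z, h z)).
Proof. by move=> cf ch z; apply: cvg_pair; [exact: cf|exact: ch]. Qed.

Lemma continuous_comp_fun (S T U : topologicalType) (f : S -> T) (h : T -> U) :
  continuous f -> continuous h -> continuous (fun z => h (f z)).
Proof. by move=> cf ch z; apply: continuous_comp; [exact: cf|exact: ch]. Qed.

Lemma continuous_slice (T U : topologicalType) (F : T * U -> R) z :
  continuous F -> continuous (fun x => F (z, x)).
Proof.
move=> cF; apply: continuous_comp_fun cF; apply: continuous_pair => x.
  exact: cvg_cst.
exact: cvg_id.
Qed.

(** Near z the functions F (w, .) are uniformly close to F (z, .) on the compact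
    [a, b], by the tube lemma. *)
Lemma continuous_param_integral (T : topologicalType) (F : T * R -> R) a b :
  continuous F -> continuous (fun z => \int[mu]_(x in `]a, b[) F (z, x)).
Proof.
move=> cF z; apply/cvgrPdist_le => e e0.
pose e' := e / (`|b - a| + 1).
have d0 : 0 < `|b - a| + 1 by rewrite ltr_wpDl.
have e'0 : 0 < e' by rewrite divr_gt0.
have near_z : \forall w \near z, `[a, b] `<=`
    [set x | `|F (z, x) - F (w, x)| <= e'].
  have /compact_near_coveringP cov := @segment_compact R a b.
  apply: (cov T (nbhs z) (fun w x => `|F (z, x) - F (w, x)| <= e')).
  move=> x _.
  have h2 : 0 < e' / 2 by rewrite divr_gt0.
  have Fzx := cF (z, x).
  move/cvgrPdist_le : Fzx => /(_ _ h2) Fzx.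
  have H1 : \forall x' \near x & w \near z, `|F (z, x) - F (w, x')| <= e' / 2.
    case: Fzx => [[A B] [/= Az Bx] AB]; exists (B, A) => // -[x' w] [/= Bx' Aw].
    exact: (AB (w, x')).
  have H2 : \forall x' \near x & w \near z, `|F (z, x) - F (z, x')| <= e' / 2.
    case: Fzx => [[A B] [/= Az Bx] AB]; exists (B, A) => // -[x' w] [/= Bx' Aw].
    by apply: (AB (z, x')); split => //=; exact: nbhs_singleton.
  apply: filterS2 H1 H2 => -[x' w] /= H1 H2.
  have -> : F (z, x') - F (w, x') =
    (F (z, x) - F (w, x')) - (F (z, x) - F (z, x')) by ring.
  by apply: (le_trans (ler_normB _ _)); rewrite [leRHS]splitr; exact: lerD.
near=> w.
have iF u := continuous_integrable_oo a b (@continuous_slice _ _ F u cF).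
rewrite -RintegralB //.
apply: le_trans (le_normr_Rintegral _ _) _ => //.
  apply: (@continuous_integrable_oo (fun x => F (z, x) - F (w, x))) => x.
  by apply: cvgB; exact: continuous_slice.
apply: (@le_trans _ _ (\int[mu]_(x in `]a, b[) e')).
  apply: le_Rintegral => //.
  - apply: (@continuous_integrable_oo (fun x => `|F (z, x) - F (w, x)|)) => x.
    apply: (@continuous_comp _ _ _ (fun x => F (z, x) - F (w, x)) Num.norm).
      by apply: cvgB; exact: continuous_slice.
    exact: norm_continuous.
  - by apply: (@continuous_integrable_oo (cst e')) => x; exact: cvg_cst.
  - move=> x /subset_itv_oo_cc; have := near near_z w; exact.
rewrite Rintegral_cst //= lebesgue_measure_itv /=; case: ifPn => ab; last first.
  by rewrite mulr0 ltW.
rewrite -EFinB /= /e' mulrAC ler_pdivrMr // ler_pM2l //.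
by rewrite (le_trans (ler_norm _)) // lerDl.
Unshelve. all: by end_near. Qed.

End IntervalIntegrals.

(** * Exchange of integrals of continuous functions *)

Section Fubini.
Variable R : realType.
Notation mu := (@lebesgue_measure R).

(** The boxes with rational corners form a countable basis of the plane, and
    boxes are measurable for the product sigma-algebra. *)
Lemma open_measurable_plane (U : set (R * R)) : open U ->
  measurable (U : set (measurableTypeR R * measurableTypeR R)).
Proof.
move=> oU.
pose box (k : rat * rat * (rat * rat)) : set (R * R) :=
  `]ratr k.1.1, ratr k.1.2[ `*` `]ratr k.2.1, ratr k.2.2[.
pose inner n := if unpickle n is Some k
  then [set p | box k p /\ box k `<=` U] else set0.
suff -> : U = \bigcup_n inner n.
  apply: bigcupT_measurable => n; rewrite /inner; case: unpickle => // k.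
  have [kU|kU] := pselect (box k `<=` U).
    rewrite [X in measurable X](_ : _ = box k).
      by apply: measurableX; exact: measurable_itv.
    by apply/seteqP; split => [p []|p].
  rewrite [X in measurable X](_ : _ = set0) //.
  by apply/seteqP; split => [p []|p].
apply/seteqP; split => [[x y] Uxy|p [n _]]; last first.
  by rewrite /inner; case: unpickle => // k [kp]; exact.
have [[A B] [/= Ax By] AB] : nbhs (x, y) U by exact: open_nbhs_nbhs.
have itv_in (C : set R) (z : R) : nbhs z C ->
    exists k : rat * rat, ratr k.1 < z < ratr k.2 /\
      `]ratr k.1, ratr k.2[ `<=` C.
  move=> /nbhs_ballP[e /= e0 eC].
  have [q1 /[!in_itv]/= /andP[q1e q1z]] : exists q, ratr q \in `]z - e, z[.
    by apply: rat_in_itvoo; rewrite ltrBlDr ltrDl.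
  have [q2 /[!in_itv]/= /andP[zq2 q2e]] : exists q, ratr q \in `]z, z + e[.
    by apply: rat_in_itvoo; rewrite ltrDl.
  exists (q1, q2); split; first by rewrite /= q1z zq2.
  move=> w /=; rewrite in_itv /= => /andP[q1w wq2]; apply: eC.
  rewrite /ball /= ltr_norml; apply/andP; split; lra.
have [k1 [xk1 k1A]] := itv_in A x Ax; have [k2 [yk2 k2B]] := itv_in B y By.
have [n nk] : exists n, unpickle n = Some (k1, k2).
  by exists (pickle (k1, k2)); rewrite pickleK.
exists n; first by []; rewrite /inner nk; split.
  by split; rewrite /= in_itv.
by move=> [x' y'] [/= x'k1 y'k2]; apply: AB; split; [exact: k1A|exact: k2B].
Qed.

Lemma continuous_measurable_plane (F : R * R -> R) : continuous F ->
  measurable_fun setT (F : measurableTypeR R * measurableTypeR R -> R).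
Proof.
move=> /continuousP cF; apply: (measurability _ (measurable_realfun.RGenOInfty.measurableE R)).
move=> _ [_ [a ->] <-]; rewrite setTI; apply: open_measurable_plane.
exact/cF/interval_open.
Qed.

(** Fubini's theorem for F cut off outside the rectangle, where it is bounded by
    compactness. *)
Lemma Rintegral_swap (F : R * R -> R) (a b c e : R) : continuous F ->
  \int[mu]_(x in `]a, b[) \int[mu]_(y in `]c, e[) F (x, y) =
  \int[mu]_(y in `]c, e[) \int[mu]_(x in `]a, b[) F (x, y).
Proof.
move=> cF.
have cFl y : continuous (fun x => F (x, y)).
  apply: continuous_comp_fun cF; apply: continuous_pair => x.
    exact: cvg_id.
  exact: cvg_cst.
have cFr x : continuous (fun y => F (x, y)) by exact: continuous_slice.
pose D : set (measurableTypeR R * measurableTypeR R) := `]a, b[ `*` `]c, e[.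
have mD : measurable D by apply: measurableX; exact: measurable_itv.
pose f : measurableTypeR R * measurableTypeR R -> \bar R := (EFin \o F) \_ D.
have intf : (mu \x mu)%E.-integrable setT f.
  have bndF : (mu \x mu)%E.-integrable D (EFin \o F); last first.
    by apply/(integrable_mkcond _ mD).
  refine (@measurable_bounded_integrable _ _ R (mu \x mu)%E F D mD _ _ _).
  - change ((mu \x mu)%E (`]a, b[%classic `*` `]c, e[%classic) < +oo)%E.
    rewrite product_measure1E //.
    rewrite lte_mul_pinfty // ?measure_ge0 //.
    + rewrite ge0_fin_numE ?measure_ge0 //= lebesgue_measure_itv /=.
      by case: ifP => _; rewrite ?ltry // -EFinB ltry.
    + by rewrite /= lebesgue_measure_itv /=; case: ifP => _; rewrite ?ltry // -EFinB ltry.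
  - apply: measurable_funS (continuous_measurable_plane cF) => //.
  - have cptK : compact (`[a, b] `*` `[c, e] : set (R * R)).
      by apply: compact_setX; exact: segment_compact.
    have /compact_bounded[M [_ HM]] := continuous_compact
      (continuous_subspaceT cF) cptK.
    exists M; split; rewrite ?num_real // => r Mr p [/= px py].
    by apply: HM Mr _ _; exists p => //; split; exact: subset_itv_oo_cc.
have /= := Fubini intf.
have inner_l x : (\int[mu]_y f (x, y) =
    (if x \in `]a, b[ then (\int[mu]_(y in `]c, e[) F (x, y)) else 0)%:E)%E.
  rewrite /f; case: ifPn => xab.
    rewrite /Rintegral fineK; last first.
      by apply: integrable_fin_num => //; exact: continuous_integrable_oo (cFr x).
    rewrite [RHS]integral_mkcond; apply: eq_integral => y _.
    by rewrite !patchE /D in_setX /= mem_setE xab.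
  rewrite integral0_eq // => y _; rewrite patchE ifF //.
  by apply/negbTE; rewrite /D in_setX /= mem_setE negb_and xab.
have inner_r y : (\int[mu]_x f (x, y) =
    (if y \in `]c, e[ then (\int[mu]_(x in `]a, b[) F (x, y)) else 0)%:E)%E.
  rewrite /f; case: ifPn => yce.
    rewrite /Rintegral fineK; last first.
      by apply: integrable_fin_num => //; exact: continuous_integrable_oo (cFl y).
    rewrite [RHS]integral_mkcond; apply: eq_integral => x _.
    by rewrite !patchE /D in_setX /= !mem_setE yce andbT.
  rewrite integral0_eq // => x _; rewrite patchE ifF //.
  by apply/negbTE; rewrite /D in_setX /= !mem_setE negb_and yce orbT.
under eq_integral do rewrite inner_l.
under [in RHS]eq_integral do rewrite inner_r.
move=> H; rewrite /Rintegral; congr fine.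
rewrite integral_mkcond [RHS]integral_mkcond.
etransitivity; [etransitivity; [|exact: H]|]; apply: eq_integral => z _.
  by rewrite patchE mem_setE; case: ifP.
by rewrite patchE mem_setE; case: ifP.
Qed.

End Fubini.

(** * Derivatives relative to a set *)

Section RelativeDerivative.
Variable R : realType.
Notation mu := (@lebesgue_measure R).
Implicit Types (E : set R) (f g : R -> R) (x l : R).

(** As a relation, the derivative restricts to smaller sets and is computed by
    rules that prove existence and value together. *)
Definition has_rderiv E f x l : Prop := rel_quotient E f x --> l.

Lemma has_rderivP E f x l : has_rderiv E f x l <->
  forall e, 0 < e -> exists2 r, 0 < r & forall y, `|y - x| < r -> y != x ->
    E y -> `|(f y - f x) / (y - x) - l| <= e.
Proof.
split=> [/cvgrPdist_le H e e0|H].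
  have /nbhs_ballP[r /= r0 Hr] := H _ e0; exists r => // y yx ynx Ey.
  by rewrite distrC; apply: Hr => //; rewrite /ball /= distrC.
apply/cvgrPdist_le => e e0; have [r r0 Hr] := H e e0.
apply/nbhs_ballP; exists r => //= y; rewrite /ball /= distrC => yx ynx Ey.
by rewrite distrC; apply: Hr.
Qed.

Lemma has_rderiv_subset E E' f x l : E' `<=` E ->
  has_rderiv E f x l -> has_rderiv E' f x l.
Proof.
move=> EE' /has_rderivP H; apply/has_rderivP => e /H[r r0 Hr].
by exists r => // y yr yx /EE' Ey; exact: Hr.
Qed.

Lemma eq_has_rderiv E f g x l : E x -> (forall y, E y -> f y = g y) ->
  has_rderiv E f x l -> has_rderiv E g x l.
Proof.
move=> Ex fg /has_rderivP H; apply/has_rderivP => e /H[r r0 Hr].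
by exists r => // y yr yx Ey; rewrite -!fg //; exact: Hr.
Qed.

Lemma has_rderiv_cst E (c : R) x : has_rderiv E (fun=> c) x 0.
Proof.
apply/has_rderivP => e e0; exists 1 => // y _ _ _.
by rewrite subrr mul0r subrr normr0 ltW.
Qed.

Lemma has_rderiv_cvg E f x l : has_rderiv E f x l ->
  f @ within E x^' --> f x.
Proof.
move=> fl.
have H : (fun y => (f y - f x) / (y - x) * (y - x) + f x) @ within E x^'
    --> l * (x - x) + f x.
  apply: cvgD; last exact: cvg_cst.
  apply: cvgM fl _; apply: cvgB; last exact: cvg_cst.
  move=> P Px; change (nbhs x (fun y => y != x -> E y -> P y)).
  by apply: filterS Px => y Py _ _.
rewrite subrr mulr0 add0r in H; apply: cvg_trans H.
apply: near_eq_cvg.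
change (nbhs x (fun y => y != x -> E y ->
  (f y - f x) / (y - x) * (y - x) + f x = f y)).
by apply: (@filterE _ (nbhs x)) => y yx _; rewrite divfK ?subrK // subr_eq0.
Qed.

Lemma has_rderiv_within_cvg E f x l : has_rderiv E f x l ->
  f @ within E (nbhs x) --> f x.
Proof.
move=> /has_rderiv_cvg /cvgrPdist_le H; apply/cvgrPdist_le => e e0.
have {}H : nbhs x (fun y => y != x -> E y -> `|f x - f y| <= e) := H _ e0.
change (nbhs x (fun y => E y -> `|f x - f y| <= e)).
apply: (@filterS _ (nbhs x) _ _ _ _ H) => y Hy Ey.
by have [->|yx] := eqVneq y x; [rewrite subrr normr0 ltW|exact: Hy].
Qed.

Lemma has_rderivD E f g x l k : has_rderiv E f x l -> has_rderiv E g x k ->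
  has_rderiv E (fun y => f y + g y) x (l + k).
Proof.
move=> fl gk; rewrite /has_rderiv /rel_quotient.
rewrite (_ : (fun y => _) =
    (fun y => (f y - f x) / (y - x) + (g y - g x) / (y - x))).
  exact: cvgD fl gk.
by apply/funext => y; rewrite -mulrDl; congr (_ / _); ring.
Qed.

Lemma has_rderivM E f g x l k : has_rderiv E f x l -> has_rderiv E g x k ->
  has_rderiv E (fun y => f y * g y) x (l * g x + f x * k).
Proof.
move=> fl gk; have gx := has_rderiv_cvg gk; rewrite /has_rderiv /rel_quotient.
rewrite (_ : (fun y => _) =
    (fun y => (f y - f x) / (y - x) * g y + f x * ((g y - g x) / (y - x)))).
  exact: cvgD (cvgM fl gx) (cvgM (cvg_cst (f x)) gk).
by apply/funext => y; ring.
Qed.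

Lemma has_rderiv_sum (I : Type) (r : seq I) (F : I -> R -> R) (l : I -> R) E x :
  (forall i, has_rderiv E (F i) x (l i)) ->
  has_rderiv E (fun y => \sum_(i <- r) F i y) x (\sum_(i <- r) l i).
Proof.
move=> H; elim: r => [|i r IH].
  rewrite big_nil; under [X in has_rderiv _ X]eq_fun do rewrite big_nil.
  exact: has_rderiv_cst.
rewrite big_cons; under [X in has_rderiv _ X]eq_fun do rewrite big_cons.
exact: has_rderivD.
Qed.

Lemma within_itv_dnbhs_proper (a b x : R) : a < b -> x \in `[a, b] ->
  ProperFilter (within `[a, b] x^').
Proof.
move=> ab /[!in_itv]/= /andP[ax xb]; apply: Build_ProperFilter_ex => P.
rewrite /dnbhs /within /= => /nbhs_ballP[r /= r0 Pr].
have [xb'|xb'] := ltP x b.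
  pose y := x + Num.min (r / 2) (b - x).
  have m0 : 0 < Num.min (r / 2) (b - x).
    by rewrite lt_min subr_gt0 xb' divr_gt0.
  have mr : Num.min (r / 2) (b - x) <= r / 2 by rewrite ge_min lexx.
  have mb : Num.min (r / 2) (b - x) <= b - x by rewrite ge_min lexx orbT.
  exists y; apply: Pr => /=.
  - rewrite /ball /= /y opprD addrA subrr sub0r normrN gtr0_norm //; lra.
  - by rewrite /y -subr_eq0 addrAC subrr add0r gt_eqF.
  - by rewrite in_itv /= /y; apply/andP; split; lra.
have xE : x = b by apply/eqP; rewrite eq_le xb.
subst x; pose y := b - Num.min (r / 2) (b - a).
have m0 : 0 < Num.min (r / 2) (b - a).
  by rewrite lt_min subr_gt0 ab divr_gt0.
have mr : Num.min (r / 2) (b - a) <= r / 2 by rewrite ge_min lexx.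
have mb : Num.min (r / 2) (b - a) <= b - a by rewrite ge_min lexx orbT.
exists y; apply: Pr => /=.
- rewrite /ball /= /y opprD opprK addrA subrr add0r gtr0_norm //; lra.
- by rewrite /y -subr_eq0 addrAC subrr add0r oppr_eq0 gt_eqF.
- by rewrite in_itv /= /y; apply/andP; split; lra.
Qed.

Lemma has_rderiv_unique (a b : R) f x l : a < b -> x \in `[a, b] ->
  has_rderiv `[a, b] f x l -> rel_derive `[a, b] f x = l.
Proof.
move=> ab xab fl; have PF := within_itv_dnbhs_proper ab xab.
exact: cvg_lim fl.
Qed.

(** Inside the interval a relative derivative is an ordinary one, and at the end
    points differentiability relative to the interval still gives the one-sided
    continuity that the fundamental theorem requires. *)
Lemma rderiv_FTC (a b : R) f f' : a < b -> continuous f' ->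
  (forall x, x \in `[a, b] -> has_rderiv `[a, b] f x (f' x)) ->
  \int[mu]_(x in `]a, b[) f' x = f b - f a.
Proof.
move=> ab cf' H; rewrite Rintegral_oo_cc // /Rintegral.
have der x : x \in `]a, b[ -> is_derive x 1 f (f' x).
  move=> xab; have xcc : x \in `[a, b] by exact: subset_itv_oo_cc.
  suff cvgl : h^-1 *: (f (h *: 1 + x) - f x) @[h --> 0^'] --> f' x.
    by apply: DeriveDef; [apply/cvg_ex; exists (f' x)|exact: cvg_lim cvgl].
  have /has_rderivP Hx := H x xcc.
  apply/cvgrPdist_le => e /Hx[r r0 Hr].
  have [s /= s0 sab] : exists2 s, 0 < s & ball x s `<=` `]a, b[.
    have /nbhs_ballP[s /= s0 sab] := near_in_itvoo xab.
    by exists s => // y /sab.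
  rewrite /dnbhs /within /=; apply/nbhs_ballP.
  exists (Num.min r s); first by rewrite /= lt_min r0.
  move=> h; rewrite /ball /= sub0r normrN lt_min => /andP[hr hs] h0.
  have hE : h = h *: 1 + x - x by rewrite addrK [h *: 1]mulr1.
  rewrite distrC [_ *: _]mulrC [X in _ / X]hE; apply: Hr.
  - by rewrite -hE.
  - by rewrite -subr_eq0 -hE.
  - apply: subset_itv_oo_cc; apply: sab; rewrite /ball /= distrC.
    by rewrite -hE.
rewrite (@continuous_FTC2 _ f' f) //.
- exact: continuous_subspaceT.
- split.
  + by move=> x /der dx; apply: ex_derive.
  + have /H /has_rderiv_within_cvg /cvgrPdist_le fa : a \in `[a, b].
      by rewrite in_itv /= lexx ltW.
    apply/cvgrPdist_le => e /fa fe.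
    have {}fe : nbhs a (fun y => y \in `[a, b] -> `|f a - f y| <= e) := fe.
    have {}fe : nbhs a^'+ (fun y => y \in `[a, b] -> `|f a - f y| <= e).
      change (nbhs a (fun y => a < y -> y \in `[a, b] -> `|f a - f y| <= e)).
      by apply: (@filterS _ (nbhs a) _ _ _ _ fe) => y fy _.
    near=> y.
    have ay : a < y by near: y; exact: nbhs_right_gt.
    have yb : y < b by near: y; exact: nbhs_right_lt.
    have : y \in `[a, b] by rewrite in_itv /= !ltW.
    by near: y; exact: fe.
  + have /H /has_rderiv_within_cvg /cvgrPdist_le fb : b \in `[a, b].
      by rewrite in_itv /= lexx ltW.
    apply/cvgrPdist_le => e /fb fe.
    have {}fe : nbhs b (fun y => y \in `[a, b] -> `|f b - f y| <= e) := fe.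
    have {}fe : nbhs b^'- (fun y => y \in `[a, b] -> `|f b - f y| <= e).
      change (nbhs b (fun y => y < b -> y \in `[a, b] -> `|f b - f y| <= e)).
      by apply: (@filterS _ (nbhs b) _ _ _ _ fe) => y fy _.
    near=> y.
    have ay : a < y by near: y; exact: nbhs_left_gt.
    have yb : y < b by near: y; exact: nbhs_left_lt.
    have : y \in `[a, b] by rewrite in_itv /= !ltW.
    by near: y; exact: fe.
- move=> x /der dx; rewrite derive1E; exact: derive_val.
Unshelve. all: by end_near. Qed.

End RelativeDerivative.

(** * Iterated integrals over the cube *)

Section IteratedIntegrals.
Variables (R : realType) (d : nat).
Notation mu := (@lebesgue_measure R).
Notation V := 'rV[R]_d.
Implicit Types (xi : V) (s : seq 'I_d).

Lemma continuous_mx (T : topologicalType) m n (f : T -> 'M[R]_(m, n)) :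
  (forall i j, continuous (fun z => f z i j)) -> continuous f.
Proof.
move=> cf z A [P Pz PA]; suff : \forall w \near z, forall i j, P i j (f w i j).
  by apply: filterS => w /PA.
apply: filter_forall => i; apply: filter_forall => j.
exact: (cf i j z _ (Pz i j)).
Qed.

Lemma continuous_coord (j : 'I_d) : continuous (fun xi : V => xi 0 j).
Proof. exact: coord_continuous. Qed.

Lemma continuous_set_coord (T : topologicalType) (u : T -> V) (i : 'I_d)
    (h : T -> R) : continuous u -> continuous h ->
  continuous (fun w => set_coord (u w) i (h w)).
Proof.
move=> cu ch; apply: continuous_mx => k j; rewrite /set_coord.
under eq_fun do rewrite mxE; case: eqP => _ //.
exact: (continuous_comp_fun cu (@continuous_coord j)).
Qed.

Lemma continuous_set_coord_line xi (i : 'I_d) :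
  continuous (fun x : R => set_coord xi i x).
Proof.
by apply: continuous_set_coord; [exact: cst_continuous|move=> w; exact: cvg_id].
Qed.

Lemma continuous_set_coord_face (i : 'I_d) (x : R) :
  continuous (fun xi : V => set_coord xi i x).
Proof.
by apply: continuous_set_coord; [move=> w; exact: cvg_id|exact: cst_continuous].
Qed.

Lemma set_coordE xi (i : 'I_d) (x : R) (j : 'I_d) : set_coord xi i x 0 j = if j == i then x else xi 0 j.
Proof. by rewrite mxE. Qed.

Lemma set_coord_same xi (i : 'I_d) (x y : R) : set_coord (set_coord xi i x) i y = set_coord xi i y.
Proof. by apply/rowP => j; rewrite !set_coordE; case: eqP. Qed.

Lemma set_coord_id xi (i : 'I_d) : set_coord xi i (xi 0 i) = xi.
Proof. by apply/rowP => j; rewrite set_coordE; case: eqP => // ->. Qed.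

Lemma set_coord_comm xi (i j : 'I_d) (x y : R) : i != j ->
  set_coord (set_coord xi i x) j y = set_coord (set_coord xi j y) i x.
Proof.
move=> ij; apply/rowP => k; rewrite !set_coordE.
by case: (eqVneq k j) => // ->; rewrite eq_sym (negbTE ij).
Qed.

(** The parameter in T is what allows the induction on s, and later carries the
    time variable. *)
Lemma continuous_iter_int_param (T : topologicalType) (F : T * V -> R) s :
  continuous F -> continuous (fun z => iter_int s (fun xi => F (z.1, xi)) z.2).
Proof.
move=> cF; elim: s => [|i s IH] /=.
  by under eq_fun do rewrite -surjective_pairing.
pose G (w : T * V * R) :=
  iter_int s (fun xi => F (w.1.1, xi)) (set_coord w.1.2 i w.2).
apply: (@continuous_param_integral _ _ G 0 1).
pose h (w : T * V * R) := (w.1.1, set_coord w.1.2 i w.2).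
apply: (@continuous_comp_fun _ _ _ h _ _ IH).
have c1 : continuous (fun w : T * V * R => w.1) by move=> w; exact: cvg_fst.
have c2 : continuous (fun w : T * V * R => w.2) by move=> w; exact: cvg_snd.
apply: continuous_pair.
  by apply: continuous_comp_fun c1 _ => w; exact: cvg_fst.
apply: continuous_set_coord c2; apply: continuous_comp_fun c1 _ => w; exact: cvg_snd.
Qed.

Lemma continuous_iter_int (f : V -> R) s : continuous f ->
  continuous (iter_int s f).
Proof.
move=> cf; pose F (z : R * V) := f z.2.
have cF : continuous F by apply: continuous_comp_fun cf => z; exact: cvg_snd.
by have := @continuous_slice _ _ _ _ (0 : R) (continuous_iter_int_param (s := s) cF).
Qed.

Lemma continuous_iter_int_line (f : V -> R) s xi (i : 'I_d) : continuous f ->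
  continuous (fun x : R => iter_int s f (set_coord xi i x)).
Proof.
move=> cf; apply: continuous_comp_fun (continuous_iter_int (s := s) cf).
exact: continuous_set_coord_line.
Qed.

(** The integral [iter_int s f xi] reads f at such points only, so hypotheses on
    integrands are required on this set and not on the whole space. *)
Definition iter_box s xi (z : V) : Prop :=
  forall j, if j \in s then is_true (0 < z 0 j < 1) else z 0 j = xi 0 j.

Lemma iter_box_cons s xi (z : V) (i : 'I_d) (x : R) : x \in `]0, 1[ ->
  iter_box s (set_coord xi i x) z -> iter_box (i :: s) xi z.
Proof.
rewrite in_itv /= => x01 zs j; have := zs j; rewrite inE set_coordE.
by case: (eqVneq j i) => /= _; case: (j \in s) => // ->.
Qed.

Lemma eq_iter_int s xi (f g : V -> R) :
  (forall z, iter_box s xi z -> f z = g z) -> iter_int s f xi = iter_int s g xi.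
Proof.
elim: s xi => [|i s IH] xi fg /=; first by apply: fg.
apply: eq_Rintegral => x /set_mem x01; apply: IH => z zs.
exact/fg/(iter_box_cons x01).
Qed.

(** Carries [Rintegral_le_bounded] through the iterated integrals: at each stage
    the majorant stays integrable because its iterated integral is continuous. *)
Lemma iter_int_le_bounded s xi (f g M : V -> R) : continuous M ->
  (forall z, iter_box s xi z -> 0 <= f z <= g z /\ g z <= M z) ->
  0 <= iter_int s f xi <= iter_int s g xi /\ iter_int s g xi <= iter_int s M xi.
Proof.
move=> cM; elim: s xi => [|i s IH] xi fg /=; first by apply: fg.
have H x : x \in `]0, 1[ -> _ :=
  fun x01 => IH (set_coord xi i x) (fun z zs => fg z (iter_box_cons x01 zs)).
have /= := @Rintegral_le_bounded _ _ _ mu `]0, 1[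
   (fun x => iter_int s f (set_coord xi i x))
   (fun x => iter_int s g (set_coord xi i x))
   (fun x => iter_int s M (set_coord xi i x)).
move=> /(_ _ _ _ _)/andP[] //.
- by move=> x /H[].
- by move=> x /H[].
- apply: (@continuous_integrable_oo _ (fun x => iter_int s M (set_coord xi i x))).
  exact: continuous_iter_int_line.
move=> -> ->; rewrite andbT; split=> //.
by apply: Rintegral_ge0 => x /H[/andP[]].
Qed.

Lemma iter_int_ge0 s xi (f : V -> R) : continuous f ->
  (forall z, iter_box s xi z -> 0 <= f z) -> 0 <= iter_int s f xi.
Proof.
move=> cf f0; have [] // := @iter_int_le_bounded s xi f f f cf.
  by move=> z /f0 ->; rewrite lexx.
by move=> /andP[].
Qed.

Lemma iter_intD s xi (f g : V -> R) : continuous f -> continuous g ->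
  iter_int s (fun z => f z + g z) xi = iter_int s f xi + iter_int s g xi.
Proof.
move=> cf cg; elim: s xi => [|i s IH] xi //=; under eq_Rintegral do rewrite IH.
apply: RintegralD => //.
  apply: (@continuous_integrable_oo _ (fun x => iter_int s f (set_coord xi i x))).
  exact: continuous_iter_int_line.
apply: (@continuous_integrable_oo _ (fun x => iter_int s g (set_coord xi i x))).
exact: continuous_iter_int_line.
Qed.

Lemma iter_intZ s xi (c : R) (f : V -> R) : continuous f ->
  iter_int s (fun z => c * f z) xi = c * iter_int s f xi.
Proof.
move=> cf; elim: s xi => [|i s IH] xi //=; under eq_Rintegral do rewrite IH.
apply: RintegralZl => //.
apply: (@continuous_integrable_oo _ (fun x => iter_int s f (set_coord xi i x))).
exact: continuous_iter_int_line.
Qed.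

Lemma iter_intB s xi (f g : V -> R) : continuous f -> continuous g ->
  iter_int s (fun z => f z - g z) xi = iter_int s f xi - iter_int s g xi.
Proof.
move=> cf cg; rewrite -mulN1r -iter_intZ // -iter_intD //.
  by apply: eq_iter_int => z _; rewrite mulN1r.
exact: continuous_comp_fun cg (@mulrl_continuous R (-1)).
Qed.

Lemma le_iter_int s xi (f g : V -> R) : continuous f -> continuous g ->
  (forall z, iter_box s xi z -> f z <= g z) -> iter_int s f xi <= iter_int s g xi.
Proof.
move=> cf cg fg; rewrite -subr_ge0 -iter_intB //; apply: iter_int_ge0.
  by move=> z; exact: cvgB (cg z) (cf z).
by move=> z /fg; rewrite subr_ge0.
Qed.

Lemma continuous_sumr (T : topologicalType) (I : Type) (r : seq I) (P : pred I)
    (f : I -> T -> R) :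
  (forall k, P k -> continuous (f k)) ->
  continuous (fun z => \sum_(k <- r | P k) f k z).
Proof.
move=> cf; elim: r => [|k r IH].
  rewrite (_ : (fun z => _) = (fun=> 0)); last by apply/funext => z; rewrite big_nil.
  by move=> z; exact: cvg_cst.
have [Pk|Pk] := boolP (P k).
  rewrite (_ : (fun z => _) = (fun z => f k z + \sum_(k <- r | P k) f k z)).
    by move=> z; exact: cvgD (cf k Pk z) (IH z).
  by apply/funext => z; rewrite big_cons Pk.
rewrite (_ : (fun z => _) = (fun z => \sum_(k <- r | P k) f k z)) //.
by apply/funext => z; rewrite big_cons (negbTE Pk).
Qed.

Lemma iter_int_sum (I : Type) (r : seq I) s xi (f : I -> V -> R) :
  (forall k, continuous (f k)) ->
  iter_int s (fun z => \sum_(k <- r) f k z) xi =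
  \sum_(k <- r) iter_int s (f k) xi.
Proof.
move=> cf; elim: r => [|k r IH].
  transitivity (iter_int s (fun z : V => 0 * (fun=> 0) z) xi).
    by apply: eq_iter_int => z _; rewrite big_nil mul0r.
  rewrite (iter_intZ _ _ _ (@cst_continuous V R 0)).
  by rewrite mul0r big_nil.
rewrite big_cons -IH -iter_intD //; last exact: continuous_sumr.
by apply: eq_iter_int => z _; rewrite big_cons.
Qed.

(** An outer integral passes through the coordinates one at a time, by exchange
    with a single integral. *)
Lemma Rintegral_iter_int (F : R * V -> R) (a b : R) s xi : continuous F ->
  \int[mu]_(x in `]a, b[) iter_int s (fun z => F (x, z)) xi =
  iter_int s (fun z => \int[mu]_(x in `]a, b[) F (x, z)) xi.
Proof.
move=> cF; elim: s xi => [|i s IH] xi //=.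
pose G (w : R * R) := iter_int s (fun z => F (w.1, z)) (set_coord xi i w.2).
have cG : continuous G.
  pose h (w : R * R) := (w.1, set_coord xi i w.2).
  apply: (@continuous_comp_fun _ _ _ h _ _ (continuous_iter_int_param (s := s) cF)).
  apply: continuous_pair; first by move=> w; exact: cvg_fst.
  by apply: continuous_set_coord; [exact: cst_continuous|move=> w; exact: cvg_snd].
have /= -> := @Rintegral_swap _ G a b 0 1 cG.
by apply: eq_Rintegral => y _; rewrite -IH.
Qed.

Lemma iter_int_set_coord s xi (i : 'I_d) (x : R) (f : V -> R) : i \notin s ->
  iter_int s f (set_coord xi i x) = iter_int s (fun z => f (set_coord z i x)) xi.
Proof.
elim: s xi => [|k s IH] xi //=; rewrite inE negb_or => /andP[ik ins].
by apply: eq_Rintegral => y _; rewrite set_coord_comm // IH.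
Qed.

(** Makes the fundamental theorem available in direction i, whatever the position
    of i in the order of integration. *)
Lemma iter_int_inner s xi (i : 'I_d) (f : V -> R) : continuous f -> uniq s -> i \in s ->
  iter_int s f xi = iter_int [seq j <- s | j != i]
    (fun z => \int[mu]_(x in `]0, 1[) f (set_coord z i x)) xi.
Proof.
move=> cf; elim: s xi => [|k s IH] xi //= /andP[ks us].
rewrite inE; case: (eqVneq k i) => [ki|ki] /=.
  move=> _; have ins : i \notin s by rewrite -ki.
  rewrite ki.
  have -> : [seq j <- s | j != i] = s.
    by apply/all_filterP/allP => j js; apply: contraNneq ins => <-.
  under eq_Rintegral do rewrite iter_int_set_coord //.
  pose F (w : R * V) := f (set_coord w.2 i w.1).
  apply: (@Rintegral_iter_int F).
  apply: continuous_comp_fun cf; apply: continuous_set_coord => w.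
    exact: cvg_snd.
  exact: cvg_fst.
by move=> si; apply: eq_Rintegral => y _; rewrite IH.
Qed.

Lemma unit_cube_set_coord (z : V) (i : 'I_d) (x : R) : @unit_cube R d z -> x \in `[0, 1] ->
  @unit_cube R d (set_coord z i x).
Proof.
by rewrite in_itv /= => zc x01 j; rewrite set_coordE; case: ifP.
Qed.

(** One term of the divergence theorem: integrate the i-th coordinate first, and
    apply the fundamental theorem on each line parallel to the i-th axis. *)
Lemma cube_int_pderiv (i : 'I_d) (f f' : V -> R) : continuous f -> continuous f' ->
  (forall z, unit_cube z ->
    has_rderiv `[0, 1] (fun x => f (set_coord z i x)) (z 0 i) (f' z)) ->
  cube_int f' = iter_int [seq j <- enum 'I_d | j != i] f (set_coord 0 i 1)
              - iter_int [seq j <- enum 'I_d | j != i] f (set_coord 0 i 0).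
Proof.
move=> cf cf' H; rewrite /cube_int (@iter_int_inner _ _ i) ?enum_uniq ?mem_enum //.
set s := (X in iter_int X _ _).
have ins : i \notin s by rewrite mem_filter eqxx.
rewrite !iter_int_set_coord // -iter_intB.
- apply: eq_iter_int => z zs.
  apply: (@rderiv_FTC _ 0 1 (fun x => f (set_coord z i x))
    (fun x => f' (set_coord z i x))) => //.
    exact: continuous_comp_fun (@continuous_set_coord_line _ _) cf'.
  move=> x x01.
  have zx : unit_cube (set_coord z i x).
    move=> j; rewrite set_coordE; case: (eqVneq j i) => [_|ji] //.
    have := zs j; rewrite mem_filter ji mem_enum /= => /andP[z0 z1].
    by rewrite !ltW.
  have := H _ zx; rewrite set_coordE eqxx.
  by under [X in has_rderiv _ X]eq_fun do rewrite set_coord_same.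
- exact: continuous_comp_fun (@continuous_set_coord_face _ _) cf.
- exact: continuous_comp_fun (@continuous_set_coord_face _ _) cf.
Qed.

End IteratedIntegrals.

(** * Extension by retraction *)

Section Clamping.
Variable R : realType.

Definition clamp (a b x : R) : R := Num.min b (Num.max a x).

Lemma clamp_in (a b x : R) : a <= b -> clamp a b x \in `[a, b].
Proof.
by move=> ab; rewrite in_itv /= /clamp le_min ab le_max lexx ge_min lexx.
Qed.

Lemma clamp_id (a b x : R) : x \in `[a, b] -> clamp a b x = x.
Proof. by rewrite in_itv /= /clamp => /andP[ax xb]; rewrite max_r // min_r. Qed.

Lemma continuous_clamp (a b : R) : continuous (clamp a b).
Proof.
have cmax : continuous (fun x : R => Num.max a x).
  apply: (@continuous_comp_fun _ _ R (fun x : R => (a, x))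
    (fun z : R * R => Num.max z.1 z.2)); last exact: max_continuous.
  by apply: continuous_pair => x; [exact: cvg_cst|exact: cvg_id].
apply: (@continuous_comp_fun _ _ R (fun x : R => (b, Num.max a x))
  (fun z : R * R => Num.min z.1 z.2)); last exact: min_continuous.
by apply: continuous_pair => //; exact: cst_continuous.
Qed.

(** With a retraction c onto A, this extends f to a continuous function. *)
Lemma continuous_comp_within (S T U : topologicalType) (A : set T)
    (f : T -> U) (c : S -> T) :
  {within A, continuous f} -> continuous c -> (forall x, A (c x)) ->
  continuous (fun x => f (c x)).
Proof.
move=> /subspace_continuousP cf cc Ac x P /(cf _ (Ac x)) Pf.
have {}Pf : nbhs (c x) (fun y => A y -> P (f y)) := Pf.
have H := cc x _ Pf.
have {}H : nbhs x (fun y => A (c y) -> P (f (c y))) := H.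
by apply: (@filterS _ (nbhs x) _ _ _ _ H) => y; apply.
Qed.

Variable d : nat.
Notation V := 'rV[R]_d.

Definition clamp_cube (xi : V) : V := \row_j clamp 0 1 (xi 0 j).

Lemma clamp_cubeP xi : unit_cube (clamp_cube xi).
Proof. by move=> j; rewrite mxE; have := @clamp_in 0 1 (xi 0 j) ler01. Qed.

Lemma clamp_cube_id xi : unit_cube xi -> clamp_cube xi = xi.
Proof. by move=> xiP; apply/rowP => j; rewrite mxE clamp_id // in_itv /=. Qed.

Lemma continuous_clamp_cube : continuous clamp_cube.
Proof.
apply: continuous_mx => i j; under eq_fun do rewrite mxE.
exact: continuous_comp_fun (@continuous_coord _ _ j) (@continuous_clamp 0 1).
Qed.

Lemma continuous_clamped (f : V -> R) : {within @unit_cube R d, continuous f} ->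
  continuous (fun xi => f (clamp_cube xi)).
Proof.
move=> cf; apply: continuous_comp_within cf continuous_clamp_cube _.
exact: clamp_cubeP.
Qed.

End Clamping.

(** * Symmetry of second derivatives *)

Section Schwarz.
Variable R : realType.
Notation mu := (@lebesgue_measure R).

(** In the interior, k is the derivative of its vanishing primitive; the end
    points follow by continuity. *)
Lemma Rintegral_eq0_continuous (k : R -> R) : continuous k ->
  (forall x, 0 < x <= 1 -> \int[mu]_(s in `]0, x[) k s = 0) ->
  forall x, x \in `[0, 1] -> k x = 0.
Proof.
move=> ck k0.
have inside x : 0 < x < 1 -> k x = 0.
  move=> /andP[x0 x1].
  have [_] := continuous_FTC1_closed x1 (continuous_integrable_cc 0 1 ck) x0 (ck x).
  move=> <-; rewrite derive1E.
  rewrite (@near_eq_derive _ _ _ _ (cst 0)) ?derive_cst //.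
  near=> y; rewrite -Rintegral_oo_cc // k0 //.
  by apply/andP; split; [|apply: ltW]; near: y;
    [exact: lt_nbhsr|exact: lt_nbhsl].
move=> x /[!in_itv]/= /andP[x0 x1].
apply/eqP; apply/negP => /negP kx0.
have e0 : 0 < `|k x| by rewrite normr_gt0.
have /cvgrPdist_lt /(_ _ e0) /nbhs_ballP[r /= r0 kr] := ck x.
(* x + h (1/2 - x) is an interior point within distance r of x. *)
pose h := Num.min r 1.
have h0 : 0 < h by rewrite lt_min r0 ltr01.
have hr : h <= r by rewrite ge_min lexx.
have h1 : h <= 1 by rewrite ge_min lexx orbT.
have := kr (x + h * (2^-1 - x)).
have -> : k (x + h * (2^-1 - x)) = 0 by apply: inside; apply/andP; split; nra.
rewrite subr0 ltxx => H; suff : false by []; apply: H.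
rewrite /ball /= opprD addrA subrr sub0r normrN ltr_norml; apply/andP; split; nra.
Unshelve. all: by end_near. Qed.

Lemma Rintegral2_rderiv (f f1 f12 : R -> R -> R) (x y : R) :
  continuous (fun z => f1 z.1 z.2) -> continuous (fun z => f12 z.1 z.2) ->
  (forall x y, x \in `[0, 1] -> y \in `[0, 1] ->
    has_rderiv `[0, 1] (f^~ y) x (f1 x y)) ->
  (forall x y, x \in `[0, 1] -> y \in `[0, 1] ->
    has_rderiv `[0, 1] (f1 x) y (f12 x y)) ->
  0 < x <= 1 -> 0 < y <= 1 ->
  \int[mu]_(s in `]0, x[) \int[mu]_(r in `]0, y[) f12 s r =
  f x y - f 0 y - (f x 0 - f 0 0).
Proof.
move=> c1 c12 d1 d12 /andP[x0 x1] /andP[y0 y1].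
have sub (w : R) : w <= 1 -> `[0, w] `<=` `[0, 1].
  by move=> w1 s /=; rewrite !in_itv /= => /andP[-> /le_trans]; apply.
have c1y r : continuous (fun s => f1 s r).
  apply: (@continuous_comp_fun _ _ _ (fun s : R => (s, r)) _ _ c1).
  by apply: continuous_pair; [move=> s; exact: cvg_id|exact: cst_continuous].
have slice (w r : R) : 0 < w <= 1 -> r \in `[0, 1] ->
    \int[mu]_(s in `]0, w[) f1 s r = f w r - f 0 r.
  move=> /andP[w0 w1] r01; apply: (@rderiv_FTC _ 0 w (f^~ r)) => // s sw.
  by apply: has_rderiv_subset (sub _ w1) _; apply: d1 => //; exact: sub sw.
rewrite -slice ?x0 // ?in_itv /= ?y1 ?ltW // -slice ?x0 // ?in_itv /= ?lexx ?ler01 //.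
rewrite -RintegralB //; last 2 first.
- exact: (continuous_integrable_oo 0 x (c1y y)).
- exact: (continuous_integrable_oo 0 x (c1y 0)).
apply: eq_Rintegral => s /set_mem /subset_itv_oo_cc s0x.
apply: (@rderiv_FTC _ 0 y (f1 s)) => // [|r ry].
  exact: (@continuous_slice _ _ _ _ s c12).
by apply: has_rderiv_subset (sub _ y1) _; apply: d12; [exact: sub s0x|exact: sub ry].
Qed.

(** Both mixed derivatives have the same integral over every rectangle [0, u] x
    [0, w], namely the alternating sum of f over its corners, by integrating in
    the two possible orders; continuous functions with equal integrals are equal.
    The argument works up to the boundary. *)
Lemma mixed_rderiv (f f1 f2 f12 f21 : R -> R -> R) :
  continuous (fun z => f1 z.1 z.2) -> continuous (fun z => f2 z.1 z.2) ->
  continuous (fun z => f12 z.1 z.2) -> continuous (fun z => f21 z.1 z.2) ->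
  (forall x y, x \in `[0, 1] -> y \in `[0, 1] ->
    [/\ has_rderiv `[0, 1] (f^~ y) x (f1 x y),
        has_rderiv `[0, 1] (f x) y (f2 x y),
        has_rderiv `[0, 1] (f1 x) y (f12 x y) &
        has_rderiv `[0, 1] (f2^~ y) x (f21 x y)]) ->
  forall x y, x \in `[0, 1] -> y \in `[0, 1] -> f12 x y = f21 x y.
Proof.
move=> c1 c2 c12 c21 H x y x01 y01; apply/eqP; rewrite -subr_eq0; apply/eqP.
pose k (z : R * R) := f12 z.1 z.2 - f21 z.1 z.2.
have ck : continuous k by move=> z; exact: cvgB (c12 z) (c21 z).
have cswap (h : R -> R -> R) : continuous (fun z => h z.1 z.2) ->
    continuous (fun z => h z.2 z.1).
  move=> ch; apply: (@continuous_comp_fun _ _ _ (fun z : R * R => (z.2, z.1)) _ _ ch).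
  by apply: continuous_pair => z; [exact: cvg_snd|exact: cvg_fst].
have int0 (u w : R) : 0 < u <= 1 -> 0 < w <= 1 ->
    \int[mu]_(s in `]0, u[) \int[mu]_(r in `]0, w[) k (s, r) = 0.
  move=> u01 w01.
  have E1 := @Rintegral2_rderiv f f1 f12 u w c1 c12
    (fun s r sP rP => let: And4 h _ _ _ := H s r sP rP in h)
    (fun s r sP rP => let: And4 _ _ h _ := H s r sP rP in h) u01 w01.
  have E2 := @Rintegral2_rderiv (fun s r => f r s) (fun s r => f2 r s)
    (fun s r => f21 r s) w u (cswap _ c2) (cswap _ c21)
    (fun s r sP rP => let: And4 _ h _ _ := H r s rP sP in h)
    (fun s r sP rP => let: And4 _ _ _ h := H r s rP sP in h) w01 u01.
  have /= swap := @Rintegral_swap _ (fun z => f21 z.1 z.2) 0 u 0 w c21.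
  rewrite /k /=.
  under eq_Rintegral => s _.
    rewrite RintegralB //; last 2 first.
    - exact: (continuous_integrable_oo 0 w (@continuous_slice _ _ _ _ s c12)).
    - exact: (continuous_integrable_oo 0 w (@continuous_slice _ _ _ _ s c21)).
    over.
  rewrite RintegralB //; last 2 first.
  - apply: (@continuous_integrable_oo _
      (fun s => \int[mu]_(r in `]0, w[) f12 s r) 0 u).
    exact: (@continuous_param_integral _ _ (fun z => f12 z.1 z.2) 0 w c12).
  - apply: (@continuous_integrable_oo _
      (fun s => \int[mu]_(r in `]0, w[) f21 s r) 0 u).
    exact: (@continuous_param_integral _ _ (fun z => f21 z.1 z.2) 0 w c21).
  by rewrite swap E1 E2; ring.
have inner (w : R) : 0 < w <= 1 -> \int[mu]_(r in `]0, w[) k (x, r) = 0.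
  move=> w01; apply: (@Rintegral_eq0_continuous
    (fun s => \int[mu]_(r in `]0, w[) k (s, r))) => //.
    exact: continuous_param_integral.
  by move=> u u01; exact: int0.
apply: (@Rintegral_eq0_continuous (fun r => k (x, r))) => //.
exact: continuous_slice.
Qed.

End Schwarz.

Section SchwarzCube.
Variables (R : realType) (d : nat).
Notation V := 'rV[R]_d.

Lemma has_rderiv_pderiv (f : V -> R) i xi : pderivable f i xi ->
  has_rderiv `[0, 1] (fun x => f (set_coord xi i x)) (xi 0 i) (pderiv f i xi).
Proof. by []. Qed.

Lemma pderiv_comm (f : V -> R) (i j : 'I_d) xi : Ck 2 f -> unit_cube xi ->
  pderiv (pderiv f i) j xi = pderiv (pderiv f j) i xi.
Proof.
move=> [_ f2] xiP; have [->//|ij] := eqVneq i j.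
have [di [ci /(_ j)[dij [cij _]]]] := f2 i.
have [dj [cj /(_ i)[dji [cji _]]]] := f2 j.
pose p (x y : R) := set_coord (set_coord xi i x) j y.
have cp : continuous (fun z : R * R => clamp_cube (p z.1 z.2)).
  apply: continuous_comp_fun (@continuous_clamp_cube R d).
  apply: continuous_set_coord; last by move=> z; exact: cvg_snd.
  apply: continuous_set_coord; first exact: cst_continuous.
  by move=> z; exact: cvg_fst.
have pP x y : x \in `[0, 1] -> y \in `[0, 1] -> unit_cube (p x y).
  by move=> x01 y01; exact: (unit_cube_set_coord j (unit_cube_set_coord i xiP x01) y01).
have pid x y : x \in `[0, 1] -> y \in `[0, 1] -> clamp_cube (p x y) = p x y.
  by move=> x01 y01; rewrite clamp_cube_id //; exact: pP.
have cK (h : V -> R) : {within @unit_cube R d, continuous h} ->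
    continuous (fun z : R * R => h (clamp_cube (p z.1 z.2))).
  by move=> ch; apply: continuous_comp_within ch cp _ => z; exact: clamp_cubeP.
have pi x y : p x y 0 i = x by rewrite /p !set_coordE (negbTE ij) eqxx.
have pj x y : p x y 0 j = y by rewrite /p !set_coordE eqxx.
have seti x y w : set_coord (p x y) i w = p w y.
  by rewrite /p set_coord_comm 1?eq_sym // set_coord_same.
have setj x y w : set_coord (p x y) j w = p x w by rewrite /p set_coord_same.
pose F (h : V -> R) (x y : R) := h (clamp_cube (p x y)).
have alongi (h : V -> R) : (forall z, unit_cube z -> pderivable h i z) ->
    forall x y, x \in `[0, 1] -> y \in `[0, 1] ->
    has_rderiv `[0, 1] ((F h)^~ y) x (F (pderiv h i) x y).
  move=> dh x y x01 y01; have := has_rderiv_pderiv (dh _ (pP x y x01 y01)).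
  rewrite pi /F pid //; apply: eq_has_rderiv => // w w01.
  by rewrite seti pid.
have alongj (h : V -> R) : (forall z, unit_cube z -> pderivable h j z) ->
    forall x y, x \in `[0, 1] -> y \in `[0, 1] ->
    has_rderiv `[0, 1] (F h x) y (F (pderiv h j) x y).
  move=> dh x y x01 y01; have := has_rderiv_pderiv (dh _ (pP x y x01 y01)).
  rewrite pj /F pid //; apply: eq_has_rderiv => // w w01.
  by rewrite setj pid.
have xi01 k : xi 0 k \in `[0, 1] by rewrite in_itv /=; exact: xiP.
have -> : xi = clamp_cube (p (xi 0 i) (xi 0 j)).
  by rewrite pid // /p !set_coord_id.
apply: (@mixed_rderiv _ (F f) (F (pderiv f i)) (F (pderiv f j))
  (F (pderiv (pderiv f i) j)) (F (pderiv (pderiv f j) i))) => //.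
- exact: cK.
- exact: cK.
- exact: cK.
- exact: cK.
- by move=> x y x01 y01; split; [exact: alongi|exact: alongj|exact: alongj|exact: alongi].
Qed.

End SchwarzCube.

(** * Derivatives of determinants and the metric identities *)

Section ReplaceRow.
Variables (K : comNzRingType) (d : nat).
Implicit Types (G : 'M[K]_d) (m n i : 'I_d) (v : 'rV[K]_d).

Definition replace_row m v G : 'M[K]_d :=
  \matrix_(a, b) if a == m then v 0 b else G a b.

Lemma det_replace_row m v G :
  \det (replace_row m v G) = \sum_j v 0 j * cofactor G m j.
Proof.
rewrite (expand_det_row _ m); apply: eq_bigr => j _; rewrite mxE eqxx.
congr (_ * (_ * \det _)); apply/matrixP => a b; rewrite !mxE.
by rewrite eq_sym (negbTE (neq_lift m a)).
Qed.

Lemma cofactor_replace_row n i G :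
  cofactor G n i = \det (replace_row n (delta_mx 0 i) G).
Proof.
rewrite det_replace_row (bigD1 i) //= !mxE !eqxx mul1r big1 ?addr0 // => j ji.
by rewrite mxE (negbTE ji) andbF mul0r.
Qed.

(** Exchanging rows m and n turns one matrix into the other. *)
Lemma det_replace_row_swap m n G (u v : 'rV[K]_d) : m != n ->
  \det (replace_row m u (replace_row n v G)) =
  - \det (replace_row m v (replace_row n u G)).
Proof.
move=> mn.
have -> : replace_row m u (replace_row n v G) =
    xrow m n (replace_row m v (replace_row n u G)).
  apply/matrixP => a b; rewrite !mxE; case: tpermP => [->|->|/eqP am /eqP an].
  - by rewrite eqxx eq_sym (negbTE mn) eqxx.
  - by rewrite eqxx eq_sym (negbTE mn) eqxx.
  - by rewrite (negbTE am) (negbTE an).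
by rewrite xrowE det_mulmx det_perm odd_tperm mn expr1 mulN1r.
Qed.

(** H is symmetric in i and j while the determinant is alternating in the basis
    vectors e_i and e_j that occupy two of its rows, so the terms cancel in
    pairs. *)
Lemma sum_symmetric_det_eq0 m n G (H : 'I_d -> 'I_d -> K) :
  (forall x : K, x = - x -> x = 0) -> m != n ->
  (forall i j, H i j = H j i) ->
  \sum_i \det (replace_row m (\row_j H j i) (replace_row n (delta_mx 0 i) G)) = 0.
Proof.
move=> char0 mn Hsym; apply: char0.
pose S i j := \det (replace_row m (delta_mx 0 j) (replace_row n (delta_mx 0 i) G)).
have E i : \det (replace_row m (\row_j H j i) (replace_row n (delta_mx 0 i) G)) =
    \sum_j H j i * S i j.
  by rewrite det_replace_row; apply: eq_bigr => j _; rewrite mxE cofactor_replace_row.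
under eq_bigr do rewrite E.
rewrite [in RHS]exchange_big /= -sumrN; apply: eq_bigr => i _.
rewrite -sumrN; apply: eq_bigr => j _.
by rewrite /S det_replace_row_swap // Hsym mulrN.
Qed.

End ReplaceRow.

Section DeterminantCalculus.
Variable R : realType.

Lemma has_rderiv_prod (I : eqType) (r : seq I) (F : I -> R -> R) (F' : I -> R)
    (E : set R) (x : R) : uniq r -> (forall i, has_rderiv E (F i) x (F' i)) ->
  has_rderiv E (fun s => \prod_(i <- r) F i s) x
    (\sum_(m <- r) \prod_(i <- r) if i == m then F' i else F i x).
Proof.
move=> + HF; elim: r => [_|i r IH /= /andP[ir ur]].
  under [X in has_rderiv _ X]eq_fun do rewrite big_nil.
  by rewrite big_nil; exact: has_rderiv_cst.
under [X in has_rderiv _ X]eq_fun do rewrite big_cons.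
rewrite big_cons big_cons eqxx.
have -> : \prod_(k <- r) (if k == i then F' k else F k x) = \prod_(k <- r) F k x.
  rewrite big_seq [RHS]big_seq; apply: eq_bigr => k kr.
  by case: eqP => // ki; rewrite -ki kr in ir.
have -> : \sum_(m <- r) \prod_(k <- i :: r) (if k == m then F' k else F k x) =
    F i x * \sum_(m <- r) \prod_(k <- r) (if k == m then F' k else F k x).
  rewrite mulr_sumr big_seq [RHS]big_seq; apply: eq_bigr => m mr.
  by rewrite big_cons; case: eqP => // im; rewrite im mr in ir.
exact: has_rderivM (HF i) (IH ur).
Qed.

(** The derivative of a determinant differentiates one row at a time. *)
Lemma has_rderiv_det n (G : R -> 'M[R]_n) (G' : 'M[R]_n) (E : set R) (x : R) :
  (forall a b, has_rderiv E (fun s => G s a b) x (G' a b)) ->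
  has_rderiv E (fun s => \det (G s)) x
    (\sum_m \det (replace_row m (row m G') (G x))).
Proof.
move=> HG.
have -> : \sum_m \det (replace_row m (row m G') (G x)) =
    \sum_(s : 'S_n) (0 * (\prod_i G x i (s i)) + (-1) ^+ s *
      \sum_m \prod_i (if i == m then G' i (s i) else G x i (s i))).
  rewrite exchange_big /=; apply: eq_bigr => s _.
  rewrite mul0r add0r mulr_sumr; apply: eq_bigr => m _; congr (_ * _).
  by apply: eq_bigr => i _; rewrite !mxE; case: eqP => // ->.
apply: has_rderiv_sum => s.
apply: (@has_rderivM _ _ (fun=> (-1) ^+ s)); first exact: has_rderiv_cst.
by apply: has_rderiv_prod => [|i]; [exact: index_enum_uniq|exact: HG].
Qed.

Lemma continuous_prodr (T : topologicalType) (I : Type) (r : seq I)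
    (f : I -> T -> R) :
  (forall k, continuous (f k)) -> continuous (fun z => \prod_(k <- r) f k z).
Proof.
move=> cf; elim: r => [|k r IH].
  rewrite (_ : (fun z => _) = (fun=> 1)); first exact: cst_continuous.
  by apply/funext => z; rewrite big_nil.
rewrite (_ : (fun z => _) = (fun z => f k z * \prod_(k <- r) f k z)).
  by move=> z; exact: cvgM (cf k z) (IH z).
by apply/funext => z; rewrite big_cons.
Qed.

Lemma continuous_det (T : topologicalType) n (G : T -> 'M[R]_n) :
  (forall a b, continuous (fun z => G z a b)) -> continuous (fun z => \det (G z)).
Proof.
move=> cG; apply: continuous_sumr => s _ z.
apply: cvgM; first exact: cvg_cst.
by apply: continuous_prodr => i; exact: cG.
Qed.

Definition has_rderiv_mx m n (E : set R) (M : R -> 'M[R]_(m, n)) (x : R)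
  (M' : 'M[R]_(m, n)) := forall a b, has_rderiv E (fun s => M s a b) x (M' a b).

Lemma has_rderiv_mulmx m n p E (M : R -> 'M[R]_(m, n)) (N : R -> 'M[R]_(n, p))
    x M' N' :
  has_rderiv_mx E M x M' -> has_rderiv_mx E N x N' ->
  has_rderiv_mx E (fun s => M s *m N s) x (M' *m N x + M x *m N').
Proof.
move=> HM HN a b; rewrite !mxE -big_split /=.
under [X in has_rderiv _ X]eq_fun do rewrite mxE.
by apply: has_rderiv_sum => l; apply: has_rderivM.
Qed.

Lemma has_rderiv_tr m n E (M : R -> 'M[R]_(m, n)) x M' :
  has_rderiv_mx E M x M' -> has_rderiv_mx E (fun s => (M s)^T) x M'^T.
Proof.
move=> HM a b; rewrite mxE; under [X in has_rderiv _ X]eq_fun do rewrite mxE.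
exact: HM.
Qed.

Definition continuous_entries (T : topologicalType) m n (M : T -> 'M[R]_(m, n)) :=
  forall a b, continuous (fun z => M z a b).

Lemma continuous_entries_mulmx (T : topologicalType) m n p
    (M : T -> 'M[R]_(m, n)) (N : T -> 'M[R]_(n, p)) :
  continuous_entries M -> continuous_entries N ->
  continuous_entries (fun z => M z *m N z).
Proof.
move=> cM cN a b; under [X in continuous X]eq_fun do rewrite mxE.
by apply: continuous_sumr => l _ z; exact: cvgM (cM a l z) (cN l b z).
Qed.

Lemma continuous_entriesD (T : topologicalType) m n (M N : T -> 'M[R]_(m, n)) :
  continuous_entries M -> continuous_entries N ->
  continuous_entries (fun z => M z + N z).
Proof.
move=> cM cN a b; under [X in continuous X]eq_fun do rewrite mxE.
by move=> z; exact: cvgD (cM a b z) (cN a b z).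
Qed.

Lemma continuous_entries_tr (T : topologicalType) m n (M : T -> 'M[R]_(m, n)) :
  continuous_entries M -> continuous_entries (fun z => (M z)^T).
Proof.
by move=> cM a b; under [X in continuous X]eq_fun do rewrite mxE; exact: cM.
Qed.

End DeterminantCalculus.

Section MetricIdentities.
Variables (R : realType) (d : nat).
Notation V := 'rV[R]_d.
Variable X : V -> V.
Hypothesis X2 : forall n, Ck 2 (fun xi => X xi 0 n).

Definition jacobian_deriv (i : 'I_d) (xi : V) : 'M[R]_d :=
  \matrix_(n, j) pderiv (pderiv (fun z => X z 0 n) j) i xi.

(** The derivative of the (n, i) cofactor in direction i. Seen as a determinant,
    the cofactor has the constant vector e_i as its row n, which therefore does
    not contribute. *)
Definition cofactor_deriv (n i : 'I_d) (xi : V) : R :=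
  \sum_(m | m != n) \det (replace_row m (row m (jacobian_deriv i xi))
    (replace_row n (delta_mx 0 i) (Defs.jacobian X xi))).

Lemma has_rderiv_jacobian i xi : unit_cube xi ->
  has_rderiv_mx `[0, 1] (fun s => Defs.jacobian X (set_coord xi i s)) (xi 0 i)
    (jacobian_deriv i xi).
Proof.
move=> xiP n j; rewrite mxE; under [X in has_rderiv _ X]eq_fun do rewrite mxE.
have [_ /(_ j)[_ [_ /(_ i)[H _]]]] := X2 n.
exact: H xi xiP.
Qed.

Lemma has_rderiv_cofactor n i xi : unit_cube xi ->
  has_rderiv `[0, 1] (fun s => cofactor (Defs.jacobian X (set_coord xi i s)) n i)
    (xi 0 i) (cofactor_deriv n i xi).
Proof.
move=> xiP; under [X in has_rderiv _ X]eq_fun do rewrite cofactor_replace_row.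
pose G' := replace_row n 0 (jacobian_deriv i xi).
have := @has_rderiv_det _ _
  (fun s => replace_row n (delta_mx 0 i) (Defs.jacobian X (set_coord xi i s))) G'
  `[0, 1] (xi 0 i).
rewrite set_coord_id (bigD1 n) //=.
have -> : \det (replace_row n (row n G')
    (replace_row n (delta_mx 0 i) (Defs.jacobian X xi))) = 0.
  rewrite det_replace_row big1 // => j _.
  by rewrite !mxE eqxx mul0r.
rewrite add0r /cofactor_deriv => H.
have -> : \sum_(m | m != n) \det (replace_row m (row m (jacobian_deriv i xi))
    (replace_row n (delta_mx 0 i) (Defs.jacobian X xi))) =
  \sum_(m | m != n) \det (replace_row m (row m G')
    (replace_row n (delta_mx 0 i) (Defs.jacobian X xi))).
  apply: eq_bigr => m mn; congr (\det (replace_row _ _ _)).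
  by apply/rowP => j; rewrite !mxE (negbTE mn).
apply: H => a b; rewrite mxE.
under [X in has_rderiv _ X]eq_fun do rewrite mxE.
case: eqP => _; first by rewrite mxE; exact: has_rderiv_cst.
exact: has_rderiv_jacobian.
Qed.

(** The Piola identity: expanding each differentiated row in the basis vectors
    leaves sums of the form treated in [sum_symmetric_det_eq0]. *)
Lemma sum_cofactor_deriv n xi : unit_cube xi -> \sum_i cofactor_deriv n i xi = 0.
Proof.
move=> xiP; rewrite exchange_big /= big1 // => m mn.
rewrite -[RHS](@sum_symmetric_det_eq0 _ _ m n (Defs.jacobian X xi)
  (fun j i => pderiv (pderiv (fun z => X z 0 m) j) i xi)) //.
- apply: eq_bigr => i _; congr (\det (replace_row _ _ _)).
  by apply/rowP => j; rewrite !mxE.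
- by move=> x /eqP; rewrite -addr_eq0 -mulr2n mulrn_eq0 /= => /eqP.
- by move=> i j; exact: pderiv_comm.
Qed.

Lemma continuous_jacobian :
  continuous_entries (fun xi => Defs.jacobian X (clamp_cube xi)).
Proof.
move=> n j; under [X in continuous X]eq_fun do rewrite mxE.
by have [_ /(_ j)[_ [cj _]]] := X2 n; exact: continuous_clamped.
Qed.

Lemma continuous_jacobian_deriv i :
  continuous_entries (fun xi => jacobian_deriv i (clamp_cube xi)).
Proof.
move=> n j; under [X in continuous X]eq_fun do rewrite mxE.
by have [_ /(_ j)[_ [_ /(_ i)[_ [cij _]]]]] := X2 n; exact: continuous_clamped.
Qed.

Lemma continuous_replace_row (T : topologicalType) m (u : T -> V)
    (G : T -> 'M[R]_d) : continuous_entries u -> continuous_entries G ->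
  continuous_entries (fun z => replace_row m (u z) (G z)).
Proof.
move=> cu cG a b; under [X in continuous X]eq_fun do rewrite mxE.
by case: eqP => _; [exact: cu|exact: cG].
Qed.

Lemma continuous_cofactor n i :
  continuous (fun xi => cofactor (Defs.jacobian X (clamp_cube xi)) n i).
Proof.
under [X in continuous X]eq_fun do rewrite cofactor_replace_row.
apply: continuous_det; apply: continuous_replace_row continuous_jacobian.
by move=> a b; exact: cst_continuous.
Qed.

Lemma continuous_cofactor_deriv n i :
  continuous (fun xi => cofactor_deriv n i (clamp_cube xi)).
Proof.
apply: continuous_sumr => m _; apply: continuous_det.
apply: continuous_replace_row.
  move=> a b; under [X in continuous X]eq_fun do rewrite mxE.
  exact: continuous_jacobian_deriv.
apply: continuous_replace_row continuous_jacobian.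
by move=> a b; exact: cst_continuous.
Qed.

End MetricIdentities.

(** * Eigenvalues and boundary conditions *)

Section BoundaryTerms.
Variables (R : realType) (N : nat).
Implicit Types (M P : 'M[R]_N) (lam w : 'rV[R]_N) (q g : 'cV[R]_N).

Definition dot m (u v : 'cV[R]_m) : R := (u^T *m v) 0 0.

Lemma dotE m (u v : 'cV[R]_m) : dot u v = \sum_k u k 0 * v k 0.
Proof. by rewrite /dot mxE; apply: eq_bigr => k _; rewrite mxE. Qed.

Lemma dotC m (u v : 'cV[R]_m) : dot u v = dot v u.
Proof. by rewrite !dotE; apply: eq_bigr => k _; rewrite mulrC. Qed.

Lemma dotDr m (u v w : 'cV[R]_m) : dot u (v + w) = dot u v + dot u w.
Proof. by rewrite /dot mulmxDr mxE. Qed.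

Lemma dotNr m (u v : 'cV[R]_m) : dot u (- v) = - dot u v.
Proof. by rewrite /dot mulmxN mxE. Qed.

Lemma dotZr m (u v : 'cV[R]_m) a : dot u (a *: v) = a * dot u v.
Proof. by rewrite /dot -scalemxAr mxE. Qed.

Lemma dot_sumr m (I : Type) (r : seq I) (u : 'cV[R]_m) (v : I -> 'cV[R]_m) :
  dot u (\sum_(i <- r) v i) = \sum_(i <- r) dot u (v i).
Proof. by rewrite /dot mulmx_sumr summxE. Qed.

Lemma dot_mulmx m n (M : 'M[R]_(m, n)) u v : dot u (M *m v) = dot (M^T *m u) v.
Proof. by rewrite /dot trmx_mul trmxK mulmxA. Qed.

Lemma dot_ge0 m (u : 'cV[R]_m) : 0 <= dot u u.
Proof. by rewrite dotE sumr_ge0 // => k _; rewrite -expr2 sqr_ge0. Qed.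

Lemma quadE m (M : 'M[R]_m) (u : 'cV[R]_m) : (u^T *m M *m u) 0 0 = dot u (M *m u).
Proof. by rewrite /dot mulmxA. Qed.

Lemma dot_diag P lam q :
  dot q (P *m diag_mx lam *m P^T *m q) = \sum_k lam 0 k * (P^T *m q) k 0 ^+ 2.
Proof.
rewrite -!mulmxA dot_mulmx dotE; apply: eq_bigr => k _.
rewrite mul_diag_mx [X in _ * X]mxE; ring.
Qed.

Section Eigen.
Variables (M P : 'M[R]_N) (lam : 'rV[R]_N).
Hypothesis eigM : sorted_eigen M P lam.

Lemma quad_eigen q : dot q (M *m q) = \sum_k lam 0 k * (P^T *m q) k 0 ^+ 2.
Proof. by have [_ -> _ _] := eigM; rewrite dot_diag. Qed.

Lemma quad_abs_minus q : dot q (abs_mx_minus P lam *m q) =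
  \sum_k - Num.min 0 (lam 0 k) * (P^T *m q) k 0 ^+ 2.
Proof.
rewrite /abs_mx_minus mulNmx dotNr /mx_minus dot_diag -sumrN.
by apply: eq_bigr => k _; rewrite mxE mulNr.
Qed.

Lemma quad_abs_minus_ge0 q : 0 <= dot q (abs_mx_minus P lam *m q).
Proof.
rewrite quad_abs_minus sumr_ge0 // => k _; rewrite mulr_ge0 ?sqr_ge0 //.
by rewrite oppr_ge0 ge_min lexx.
Qed.

Lemma mx_minus_sym : (mx_minus P lam)^T = mx_minus P lam.
Proof. by rewrite /mx_minus /lam_minus !trmx_mul trmxK tr_diag_mx mulmxA. Qed.

(** As A^- is symmetric, g^T A^- g depends on g through A^- g only. *)
Lemma quad_abs_minus_data q g : mx_minus P lam *m q = mx_minus P lam *m g ->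
  dot g (abs_mx_minus P lam *m g) = dot q (abs_mx_minus P lam *m q).
Proof.
move=> qg; rewrite /abs_mx_minus !mulNmx !dotNr; congr (- _).
by rewrite -qg dot_mulmx mx_minus_sym -qg dotC.
Qed.

Lemma quad_le_abs_minus q :
  - dot q (M *m q) <= dot q (abs_mx_minus P lam *m q).
Proof.
rewrite quad_eigen quad_abs_minus -sumrN; apply: ler_sum => k _.
by rewrite -mulNr ler_wpM2r ?sqr_ge0 // lerN2 ge_min lexx orbT.
Qed.

(** The bound 1 + lam^2 on the negative part of lam gives a majorant that is
    expressed without P and lam, hence continuous along a face when M and q
    are. *)
Lemma quad_abs_minus_le q :
  dot q (abs_mx_minus P lam *m q) <= dot q q + dot (M *m q) (M *m q).
Proof.
have [PP ME _ _] := eigM; have PP' := mulmx1C PP.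
have -> : dot q q = dot (P^T *m q) (P^T *m q).
  by rewrite dot_mulmx trmxK mulmxA PP' mul1mx.
have -> : dot (M *m q) (M *m q) =
    \sum_k (lam 0 k * (P^T *m q) k 0) ^+ 2.
  rewrite ME -!mulmxA dot_mulmx !mulmxA PP mul1mx -mulmxA dotE.
  by apply: eq_bigr => k _; rewrite mul_diag_mx mxE expr2.
rewrite quad_abs_minus dotE -big_split /=; apply: ler_sum => k _.
have : - Num.min 0 (lam 0 k) <= 1 + lam 0 k ^+ 2.
  by rewrite minElt; case: ifP => _; nra.
have := sqr_ge0 ((P^T *m q) k 0); nra.
Qed.

(** The reflection condition says that w = P^T q is a fixed vector of R, so that
    q^T M q = w^T (Lambda^+ + Lambda^-) w is the value of the dissipative form
    at w. *)
Lemma quad_reflection_ge0 (Rbar : 'M[R]_N) q :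
  dissipative_reflection lam Rbar -> reflection_condition lam Rbar (P^T *m q) ->
  0 <= dot q (M *m q).
Proof.
have [_ _ lam0 _] := eigM; move=> [_ psd] refl; rewrite quad_eigen.
set w := P^T *m q in refl *.
have Rw : reflection_mx lam Rbar *m w = w.
  apply/matrixP => i j; rewrite ord1 [LHS]mxE {j}.
  have [li|li] := ltP 0 (lam 0 i).
    rewrite (bigD1 i) //= [X in X * _]mxE li eqxx mul1r big1 ?addr0 // => j ji.
    by rewrite [X in X * _]mxE li eq_sym (negbTE ji) mul0r.
  have {}li : lam 0 i < 0 by rewrite lt_neqAle lam0 li.
  rewrite [RHS]refl // [RHS]big_mkcond /=; apply: eq_bigr => j _.
  by rewrite [X in X * _]mxE ltNge (ltW li) /=; case: ifP => // _; rewrite mul0r.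
have diagE (l : 'rV[R]_N) k : (diag_mx l *m w) k 0 = l 0 k * w k 0.
  by rewrite mul_diag_mx mxE.
have := psd w; rewrite quadE mulmxDl dotDr -!mulmxA Rw.
rewrite [X in _ + X]dot_mulmx trmxK Rw !dotE -big_split /=.
move=> /le_trans; apply; apply: ler_sum => k _.
rewrite /lam_plus /lam_minus !diagE !mxE /Num.max /Num.min.
by case: ifP => _; nra.
Qed.

End Eigen.
End BoundaryTerms.

(** * The energy balance *)

Section Coefficients.
Variables (R : realType) (d N : nat).
Notation V := 'rV[R]_d.
Variables (X : V -> V) (Omega : set V) (J : V -> R) (A : 'I_d -> 'M[R]_N).
Hypothesis hX : smooth_mapping X Omega J.
Hypothesis hJ : bounded_positive J.
Hypothesis hA : forall i, (A i)^T = A i.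

Let X2 n : Ck 2 (fun xi => X xi 0 n).
Proof. by have [_ + _] := hX; exact. Qed.

Lemma jacobian_det_gt0 xi : unit_cube xi -> 0 < J xi.
Proof.
by have [a [b [a0 H]]] := hJ => /H /andP[+ _]; exact: lt_le_trans.
Qed.

(** The scaled inverse is the adjugate since the determinant is J > 0. *)
Lemma contravariantE xi i n : unit_cube xi ->
  contravariant X xi i n = cofactor (Defs.jacobian X xi) n i.
Proof.
move=> xiP; have [_ _ /(_ xi xiP) detJ] := hX.
have J0 : \det (Defs.jacobian X xi) != 0 by rewrite detJ gt_eqF // jacobian_det_gt0.
rewrite /contravariant /invmx unitmxE unitfE J0 scalerA divff // scale1r.
by rewrite mxE.
Qed.

Lemma contra_coefE xi i : unit_cube xi ->
  contra_coef X A xi i = \sum_n cofactor (Defs.jacobian X xi) n i *: A n.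
Proof. by move=> xiP; apply: eq_bigr => n _; rewrite contravariantE. Qed.

Lemma contra_coef_sym xi i : (contra_coef X A xi i)^T = contra_coef X A xi i.
Proof.
by rewrite linear_sum; apply: eq_bigr => n _; rewrite linearZ /= hA.
Qed.

Definition contra_coef_deriv (i : 'I_d) (xi : V) : 'M[R]_N :=
  \sum_n cofactor_deriv X n i xi *: A n.

(** The metric identities, weighted by the matrices A_n. *)
Lemma sum_contra_coef_deriv xi : unit_cube xi ->
  \sum_i contra_coef_deriv i xi = 0.
Proof.
move=> xiP; rewrite exchange_big /= big1 // => n _.
by rewrite -scaler_suml sum_cofactor_deriv // scale0r.
Qed.

Lemma has_rderiv_contra_coef i xi : unit_cube xi ->
  has_rderiv_mx `[0, 1] (fun s => contra_coef X A (set_coord xi i s) i) (xi 0 i)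
    (contra_coef_deriv i xi).
Proof.
move=> xiP a b; have x01 : xi 0 i \in `[0, 1] by rewrite in_itv /=; exact: xiP.
have E s : s \in `[0, 1] -> \sum_n cofactor (Defs.jacobian X (set_coord xi i s)) n i
    * A n a b = contra_coef X A (set_coord xi i s) i a b.
  move=> s01; rewrite contra_coefE; last exact: unit_cube_set_coord.
  by rewrite summxE; apply: eq_bigr => n _; rewrite mxE.
apply: eq_has_rderiv x01 E _.
rewrite summxE; apply: has_rderiv_sum => n; rewrite mxE.
have -> : cofactor_deriv X n i xi * A n a b =
  cofactor_deriv X n i xi * A n a b +
  cofactor (Defs.jacobian X (set_coord xi i (xi 0 i))) n i * 0.
  by rewrite mulr0 addr0.
by apply: has_rderivM; [exact: has_rderiv_cofactor|exact: has_rderiv_cst].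
Qed.

Lemma continuous_contra_coef i :
  continuous_entries (fun xi => contra_coef X A (clamp_cube xi) i).
Proof.
move=> a b; rewrite (_ : (fun xi => _) = (fun xi => \sum_n
  cofactor (Defs.jacobian X (clamp_cube xi)) n i * A n a b)).
  apply: continuous_sumr => n _ xi.
  exact: cvgM (@continuous_cofactor _ _ _ X2 n i xi) (cvg_cst _).
apply/funext => xi; rewrite contra_coefE; last exact: clamp_cubeP.
by rewrite summxE; apply: eq_bigr => n _; rewrite mxE.
Qed.

Lemma continuous_contra_coef_deriv i :
  continuous_entries (fun xi => contra_coef_deriv i (clamp_cube xi)).
Proof.
move=> a b; rewrite (_ : (fun xi => _) = (fun xi => \sum_n
  cofactor_deriv X n i (clamp_cube xi) * A n a b)).
  apply: continuous_sumr => n _ xi.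
  exact: cvgM (@continuous_cofactor_deriv _ _ _ X2 n i xi) (cvg_cst _).
by apply/funext => xi; rewrite summxE; apply: eq_bigr => n _; rewrite mxE.
Qed.

Lemma continuous_jacobian_det : continuous (fun xi => J (clamp_cube xi)).
Proof.
have [_ _ detJ] := hX.
rewrite (_ : (fun xi => _) = (fun xi => \det (Defs.jacobian X (clamp_cube xi)))).
  exact/continuous_det/continuous_jacobian.
by apply/funext => xi; rewrite detJ //; exact: clamp_cubeP.
Qed.

End Coefficients.

Section Energy.
Variables (R : realType) (d N : nat).
Notation mu := (@lebesgue_measure R).
Notation V := 'rV[R]_d.
Variables (X : V -> V) (Omega : set V) (J : V -> R) (A : 'I_d -> 'M[R]_N).
Hypothesis hX : smooth_mapping X Omega J.
Hypothesis hJ : bounded_positive J.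
Hypothesis hA : forall i, (A i)^T = A i.
Variables (I : set R) (q : V -> R -> 'cV[R]_N) (t : R).
Hypothesis t0 : 0 < t.
Hypothesis It : `[0, t] `<=` I.
Hypothesis hC1 : forall k, C1_spacetime I (fun xi s => q xi s k 0).
Hypothesis heq : forall xi s k, unit_cube xi -> I s ->
  J xi * rel_derive I (fun s => q xi s k 0) s
  + \sum_(i < d)
     pderiv (fun z => (contra_coef X A z i *m q z s) k 0) i xi = 0.

Definition q_x (i : 'I_d) (xi : V) (s : R) : 'cV[R]_N :=
  \col_k pderiv (fun z => q z s k 0) i xi.
Definition q_t (xi : V) (s : R) : 'cV[R]_N :=
  \col_k rel_derive I (fun s => q xi s k 0) s.

Definition density (xi : V) (s : R) : R := J xi * dot (q xi s) (q xi s).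
Definition density_t (xi : V) (s : R) : R :=
  J xi * (dot (q_t xi s) (q xi s) + dot (q xi s) (q_t xi s)).
Definition flux (i : 'I_d) (xi : V) (s : R) : R :=
  dot (q xi s) (contra_coef X A xi i *m q xi s).
Definition flux_x (i : 'I_d) (xi : V) (s : R) : R :=
  dot (q_x i xi s) (contra_coef X A xi i *m q xi s) +
  dot (q xi s) (contra_coef_deriv X A i xi *m q xi s
                + contra_coef X A xi i *m q_x i xi s).

Lemma has_rderiv_q i xi s : unit_cube xi -> I s ->
  has_rderiv_mx `[0, 1] (fun x => q (set_coord xi i x) s) (xi 0 i) (q_x i xi s).
Proof.
move=> xiP Is k j; rewrite ord1 mxE.
by have [_ /(_ i xi s xiP Is) + _ _ _] := hC1 k.
Qed.

Lemma has_rderiv_Aq i xi s : unit_cube xi -> I s ->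
  has_rderiv_mx `[0, 1] (fun x => contra_coef X A (set_coord xi i x) i
                               *m q (set_coord xi i x) s) (xi 0 i)
   (contra_coef_deriv X A i xi *m q xi s + contra_coef X A xi i *m q_x i xi s).
Proof.
move=> xiP Is; have := has_rderiv_mulmx
  (has_rderiv_contra_coef hX hJ (A := A) (i := i) xiP) (has_rderiv_q (i := i) xiP Is).
by rewrite set_coord_id.
Qed.

Lemma has_rderiv_flux i xi s : unit_cube xi -> I s ->
  has_rderiv `[0, 1] (fun x => flux i (set_coord xi i x) s) (xi 0 i)
    (flux_x i xi s).
Proof.
move=> xiP Is; have := has_rderiv_mulmx
  (has_rderiv_tr (has_rderiv_q (i := i) xiP Is)) (has_rderiv_Aq (i := i) xiP Is).
by move=> /(_ 0 0); rewrite set_coord_id mxE.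
Qed.

Lemma has_rderiv_density xi s : unit_cube xi -> s \in `[0, t] ->
  has_rderiv `[0, t] (density xi) s (density_t xi s).
Proof.
move=> xiP st; apply: (has_rderiv_subset It).
have Hq : has_rderiv_mx I (q xi) s (q_t xi s).
  move=> k j; rewrite ord1 mxE.
  by have [_ _ _ /(_ xi s xiP (It st)) + _] := hC1 k.
have := has_rderiv_mulmx (has_rderiv_tr Hq) Hq.
move=> /(_ 0 0) H; rewrite /density_t -[X in has_rderiv _ _ _ X]add0r.
rewrite -(mul0r (dot (q xi s) (q xi s))).
apply: has_rderivM; first exact: has_rderiv_cst.
by move: H; rewrite mxE.
Qed.

(** Symmetry of the coefficients makes the two terms q_x^T A~ q and q^T A~ q_x of
    the flux derivative equal; the remaining term sums to zero over i by the
    metric identities. *)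
Lemma conservation xi s : unit_cube xi -> I s ->
  density_t xi s = - \sum_i flux_x i xi s.
Proof.
move=> xiP Is.
have pde : J xi *: q_t xi s = - \sum_i (contra_coef_deriv X A i xi *m q xi s
    + contra_coef X A xi i *m q_x i xi s).
  apply/eqP; rewrite -addr_eq0; apply/eqP/colP => k; rewrite 2!mxE summxE.
  rewrite [RHS]mxE -[RHS](heq k xiP Is) mxE; congr (_ + _).
  apply: eq_bigr => i _; apply/esym; apply: has_rderiv_unique (ltr01) _ _.
    by rewrite in_itv /=; exact: xiP.
  exact: has_rderiv_Aq.
have sumD : \sum_i dot (q xi s) (contra_coef_deriv X A i xi *m q xi s) = 0.
  rewrite -dot_sumr -mulmx_suml (sum_contra_coef_deriv A hX) // mul0mx.
  by rewrite /dot mulmx0 mxE.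
have -> : density_t xi s = 2 * dot (q xi s) (J xi *: q_t xi s).
  by rewrite dotZr /density_t [dot (q_t _ _) _]dotC; ring.
rewrite pde dotNr dot_sumr mulrN; congr (- _).
have -> : \sum_i flux_x i xi s =
    \sum_i (2 * dot (q xi s) (contra_coef_deriv X A i xi *m q xi s
      + contra_coef X A xi i *m q_x i xi s)
      - dot (q xi s) (contra_coef_deriv X A i xi *m q xi s)).
  apply: eq_bigr => i _; rewrite /flux_x.
  have -> : dot (q_x i xi s) (contra_coef X A xi i *m q xi s) =
      dot (q xi s) (contra_coef X A xi i *m q_x i xi s).
    by rewrite dot_mulmx contra_coef_sym // dotC.
  by rewrite !dotDr; ring.
by rewrite big_split /= sumrN sumD subr0 mulr_sumr.
Qed.

Lemma continuous_spacetime (f : V -> R -> R) :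
  {within @unit_cube R d `*` I, continuous (fun z => f z.1 z.2)} ->
  continuous (fun w : R * V => f (clamp_cube w.2) (clamp 0 t w.1)).
Proof.
move=> cf; pose c (w : R * V) := (clamp_cube w.2, clamp 0 t w.1).
apply: (@continuous_comp_within _ _ _ _ _ c cf).
  apply: continuous_pair.
    by apply: continuous_comp_fun (@continuous_clamp_cube R d) => w; exact: cvg_snd.
  by apply: continuous_comp_fun (@continuous_clamp R 0 t) => w; exact: cvg_fst.
by move=> w; split; [exact: clamp_cubeP|exact/It/clamp_in/ltW].
Qed.

Let cl (w : R * V) := clamp_cube w.2.
Let ct (w : R * V) := clamp 0 t w.1.

Lemma continuous_q : continuous_entries (fun w => q (cl w) (ct w)).
Proof.
move=> k j; rewrite ord1; have [cq _ _ _ _] := hC1 k.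
exact: (@continuous_spacetime (fun xi s => q xi s k 0) cq).
Qed.

Lemma continuous_q_x i : continuous_entries (fun w => q_x i (cl w) (ct w)).
Proof.
move=> k j; rewrite ord1; have [_ _ /(_ i) cq _ _] := hC1 k.
under [X in continuous X]eq_fun do rewrite mxE.
exact: (@continuous_spacetime (fun xi s => pderiv (fun z => q z s k 0) i xi) cq).
Qed.

Lemma continuous_q_t : continuous_entries (fun w => q_t (cl w) (ct w)).
Proof.
move=> k j; rewrite ord1; have [_ _ _ _ cq] := hC1 k.
under [X in continuous X]eq_fun do rewrite mxE.
exact: (@continuous_spacetime (fun xi s => rel_derive I (fun s => q xi s k 0) s) cq).
Qed.

Lemma continuous_of_space (f : V -> R) : continuous (fun xi => f (clamp_cube xi)) ->
  continuous (fun w => f (cl w)).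
Proof.
move=> cf; apply: (@continuous_comp_fun _ _ _ (fun w : R * V => w.2) _ _ cf).
by move=> w; exact: cvg_snd.
Qed.

Lemma continuous_dot (T : topologicalType) m (u v : T -> 'cV[R]_m) :
  continuous_entries u -> continuous_entries v ->
  continuous (fun z => dot (u z) (v z)).
Proof.
move=> cu cv; have := continuous_entries_mulmx (continuous_entries_tr cu) cv.
exact.
Qed.

Lemma continuous_coef i : continuous_entries (fun w => contra_coef X A (cl w) i).
Proof.
move=> a b; apply: (@continuous_of_space (fun xi => contra_coef X A xi i a b)).
exact: (continuous_contra_coef hX hJ).
Qed.

Lemma continuous_coef_mul i :
  continuous_entries (fun w => contra_coef X A (cl w) i *m q (cl w) (ct w)).
Proof. exact: continuous_entries_mulmx (@continuous_coef i) continuous_q. Qed.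

Lemma continuous_density_t : continuous (fun w => density_t (cl w) (ct w)).
Proof.
move=> w; apply: cvgM; first exact: (continuous_of_space (continuous_jacobian_det hX)).
apply: cvgD; first exact: (continuous_dot continuous_q_t continuous_q).
exact: (continuous_dot continuous_q continuous_q_t).
Qed.

Lemma continuous_density : continuous (fun w => density (cl w) (ct w)).
Proof.
move=> w; apply: cvgM; first exact: (continuous_of_space (continuous_jacobian_det hX)).
exact: (continuous_dot continuous_q continuous_q).
Qed.

Lemma continuous_flux i : continuous (fun w => flux i (cl w) (ct w)).
Proof. exact: continuous_dot continuous_q (@continuous_coef_mul i). Qed.

Lemma continuous_flux_x i : continuous (fun w => flux_x i (cl w) (ct w)).
Proof.
move=> w; apply: cvgD; first exact: (continuous_dot (@continuous_q_x i) (@continuous_coef_mul i)).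
apply: (continuous_dot continuous_q); apply: continuous_entriesD.
  apply: (fun h => continuous_entries_mulmx h continuous_q) => a b.
  apply: (@continuous_of_space (fun xi => contra_coef_deriv X A i xi a b)).
  exact: (@continuous_contra_coef_deriv _ _ _ _ _ _ A hX i a b).
exact: continuous_entries_mulmx (@continuous_coef i) (@continuous_q_x i).
Qed.

Let face (i : 'I_d) := [seq j <- enum 'I_d | j != i].

(** The energy entering through the face xi_i = b: the outward normal is e_i if
    b is true and - e_i otherwise, and the energy leaves along it. *)
Definition influx (i : 'I_d) (b : bool) (w : R * V) : R :=
  (if b then -1 else 1) * flux i (cl w) (ct w).

Lemma continuous_influx i b : continuous (influx i b).
Proof.
exact: continuous_comp_fun (@continuous_flux i)
  (@mulrl_continuous R (if b then -1 else 1)).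
Qed.

Lemma continuous_iter_int_time (G : R * V -> R) (l : seq 'I_d) (xi : V) :
  continuous G -> continuous (fun s => iter_int l (fun z => G (s, z)) xi).
Proof.
move=> cG; apply: (@continuous_comp_fun _ _ _ (fun s : R => (s, xi)) _ _
  (continuous_iter_int_param (s := l) cG)).
by apply: continuous_pair; [move=> s; exact: cvg_id|exact: cst_continuous].
Qed.

Lemma cube_int_density_t s : s \in `[0, t] ->
  cube_int (fun z => density_t (clamp_cube z) (clamp 0 t s)) =
  \sum_i \sum_b iter_int (face i) (fun z => influx i b (s, z)) (set_coord 0 i b%:R).
Proof.
move=> s0t; have Is : I (clamp 0 t s) by exact/It/clamp_in/ltW.
pose fx i z := flux_x i (clamp_cube z) (clamp 0 t s).
have cfx i : continuous (fx i).
  exact: (@continuous_slice _ _ _ _ s (@continuous_flux_x i)).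
transitivity (cube_int (fun z => \sum_i -1 * fx i z)).
  apply: eq_iter_int => z _; rewrite conservation //; last exact: clamp_cubeP.
  by rewrite -mulr_sumr mulN1r.
rewrite /cube_int iter_int_sum; last first.
  by move=> i; exact: continuous_comp_fun (cfx i) (@mulrl_continuous R (-1)).
apply: eq_bigr => i _; rewrite iter_intZ //.
pose f z := flux i (clamp_cube z) (clamp 0 t s).
have cf : continuous f.
  exact: (@continuous_slice _ _ _ _ s (@continuous_flux i)).
have := @cube_int_pderiv _ _ i f (fx i) cf (cfx i).
rewrite /cube_int => ->; last first.
  move=> z zP; have z01 : z 0 i \in `[0, 1] by rewrite in_itv /=; exact: zP.
  rewrite /f /fx clamp_cube_id //.
  apply: eq_has_rderiv z01 _ (has_rderiv_flux (i := i) zP Is) => x x01.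
  by rewrite clamp_cube_id //; exact: unit_cube_set_coord.
rewrite big_bool /influx /= !iter_intZ //.
by rewrite /cl /ct /= /f; ring.
Qed.

(** The density is the integral of its time derivative, and the exchange of the
    time integral with the space integrals brings the divergence theorem inside
    the time integral. *)
Lemma energy_balance :
  cube_int (fun xi => density xi t) - cube_int (fun xi => density xi 0) =
  \int[mu]_(s in `]0, t[) \sum_i \sum_b
    iter_int (face i) (fun z => influx i b (s, z)) (set_coord 0 i b%:R).
Proof.
have boxP z : iter_box (enum 'I_d) 0 z -> unit_cube z.
  by move=> zb j; have := zb j; rewrite mem_enum => /andP[z0 z1]; rewrite !ltW.
have zt : 0 \in `[0, t] by rewrite in_itv /= lexx ltW.
have tt : t \in `[0, t] by rewrite in_itv /= lexx ltW.
pose D (w : R * V) := density (cl w) (ct w).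
have cD s : continuous (fun z => D (s, z)).
  exact: (@continuous_slice _ _ _ _ s continuous_density).
have atE s : s \in `[0, t] ->
    cube_int (fun xi => density xi s) = cube_int (fun z => D (s, z)).
  move=> st; apply: eq_iter_int => z /boxP zP.
  by rewrite /D /cl /ct /= clamp_cube_id // clamp_id.
rewrite !atE // /cube_int -iter_intB //.
under [RHS]eq_Rintegral => s /set_mem /subset_itv_oo_cc s0t
  do rewrite -cube_int_density_t //.
rewrite (@Rintegral_iter_int _ _ (fun w => density_t (cl w) (ct w)) 0 t); last first.
  exact: continuous_density_t.
apply: eq_iter_int => z /boxP zP; rewrite /D /cl /ct /= !clamp_id //.
apply/esym; apply: (@rderiv_FTC _ 0 t (density (clamp_cube z))
  (fun s => density_t (clamp_cube z) (clamp 0 t s))) => //.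
  have cw : continuous (fun s : R => (s, z)).
    by apply: continuous_pair; [move=> s; exact: cvg_id|exact: cst_continuous].
  exact: continuous_comp_fun cw continuous_density_t.
move=> s st; rewrite clamp_id //; apply: has_rderiv_density st.
exact: clamp_cubeP.
Qed.

Variables (Dg Dr : set V) (g : V -> R -> 'cV[R]_N).
Variables (P : V -> 'M[R]_N) (lam : V -> 'rV[R]_N) (Rbar : V -> 'M[R]_N).
Hypothesis hsplit : Dg `|` Dr = @cube_boundary R d.
Hypothesis hP : forall xi, regular_boundary xi ->
  sorted_eigen (normal_mx X A xi) (P xi) (lam xi).
Hypothesis hR : forall xi, Dr xi -> regular_boundary xi ->
  dissipative_reflection (lam xi) (Rbar xi).
Hypothesis hDg : forall xi s, Dg xi -> regular_boundary xi -> I s ->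
  mx_minus (P xi) (lam xi) *m q xi s = mx_minus (P xi) (lam xi) *m g (X xi) s.
Hypothesis hDr : forall xi s, Dr xi -> regular_boundary xi -> I s ->
  reflection_condition (lam xi) (Rbar xi) ((P xi)^T *m q xi s).

Definition data_flux (s : R) (xi : V) : R :=
  ((g (X xi) s)^T *m abs_mx_minus (P xi) (lam xi) *m g (X xi) s) 0 0.

(** Interior points of the faces are the points where the boundary conditions are
    imposed; there a single component of the normal is nonzero. *)
Lemma face_point i (b : bool) z : iter_box (face i) (set_coord 0 i b%:R) z ->
  [/\ regular_boundary z, unit_cube z, cube_boundary z &
      normal_mx X A z = (if b then 1 else -1) *: contra_coef X A z i].
Proof.
move=> zb.
have zi : z 0 i = b%:R.
  by have := zb i; rewrite mem_filter eqxx /= set_coordE eqxx.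
have zj j : j != i -> 0 < z 0 j < 1.
  by move=> ji; have := zb j; rewrite mem_filter ji mem_enum.
have zi01 : z 0 i = 0 \/ z 0 i = 1 by rewrite zi; case: b {zi zb}; [right|left].
have zP : unit_cube z.
  move=> j; have [->|/zj/andP[z0 z1]] := eqVneq j i; last by rewrite !ltW.
  by rewrite zi; case: b {zi zb}; rewrite ?lexx ler01.
split=> //; first by exists i.
  by split => //; exists i.
rewrite /normal_mx (bigD1 i) //= big1 ?addr0 => [|j /zj/andP[z0 z1]].
  rewrite mxE zi; case: b {zi zb}; rewrite /= ?eqxx ?oner_eq0 ?subr0 //.
  by rewrite eq_sym oner_eq0 sub0r.
by rewrite mxE (gt_eqF z0) (lt_eqF z1) subrr scale0r.
Qed.

(** A point may belong to both parts of the boundary; it is then treated as a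
    data point, in accordance with the indicator function of Dg. The positive
    part is taken because monotonicity of the integral without measurability
    holds between nonnegative functions. *)
Lemma influx_le_data i (b : bool) z s :
  iter_box (face i) (set_coord 0 i b%:R) z -> s \in `[0, t] ->
  0 <= Num.max 0 (influx i b (s, z)) <= \1_Dg z * data_flux s z /\
  \1_Dg z * data_flux s z <= dot (q (cl (s, z)) (ct (s, z))) (q (cl (s, z)) (ct (s, z)))
    + dot (contra_coef X A (cl (s, z)) i *m q (cl (s, z)) (ct (s, z)))
          (contra_coef X A (cl (s, z)) i *m q (cl (s, z)) (ct (s, z))).
Proof.
move=> /face_point[reg zP bd nE] st; have Is := It st.
rewrite /influx /cl /ct /= clamp_cube_id // clamp_id //.
have eig := hP reg.
have sg : (if b then -1 else 1) * flux i z s =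
    - dot (q z s) (normal_mx X A z *m q z s).
  by rewrite nE -scalemxAl dotZr /flux; case: b {nE}; ring.
have nn : dot (contra_coef X A z i *m q z s) (contra_coef X A z i *m q z s) =
    dot (normal_mx X A z *m q z s) (normal_mx X A z *m q z s).
  rewrite nE -scalemxAl dotZr [dot (_ *: _) _]dotC dotZr.
  by case: b {nE sg}; ring.
rewrite sg nn le_max lexx /= ge_max.
have [zg|zg] := pselect (Dg z).
  have -> : \1_Dg z = 1 :> R by rewrite indicE mem_set.
  rewrite mul1r /data_flux quadE.
  rewrite (quad_abs_minus_data (hDg zg reg Is)).
  rewrite quad_abs_minus_ge0 (quad_le_abs_minus eig) /=.
  by split => //; exact: quad_abs_minus_le.
have zr : Dr z.
  by have : (Dg `|` Dr) z; [rewrite hsplit|case].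
rewrite indicE memNset // mul0r lexx /=; split; last by rewrite addr_ge0 ?dot_ge0.
rewrite oppr_le0; apply: quad_reflection_ge0 eig _ _ (hR zr reg) _.
exact: hDr.
Qed.

(** The entering energy is first replaced by its positive part, which is still
    continuous, and then compared with the data term; a continuous majorant
    ensures that the integral of the latter is finite. *)
Lemma energy_inequality :
  cube_int (fun xi => density xi t) <= cube_int (fun xi => density xi 0)
    + \int[mu]_(s in `[0, t]) surface_int Dg (data_flux s).
Proof.
rewrite -lerBlDl energy_balance.
pose pos i b w := Num.max 0 (influx i b w).
have cpos i b : continuous (pos i b).
  apply: (@continuous_comp_fun _ _ _ (fun w => (0, influx i b w))
    (fun z : R * R => Num.max z.1 z.2)); last exact: max_continuous.
  by apply: continuous_pair; [exact: cst_continuous|exact: continuous_influx].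
pose bnd i (w : R * V) := dot (q (cl w) (ct w)) (q (cl w) (ct w))
  + dot (contra_coef X A (cl w) i *m q (cl w) (ct w))
        (contra_coef X A (cl w) i *m q (cl w) (ct w)).
have cbnd i : continuous (bnd i).
  move=> w; apply: cvgD; first exact: (continuous_dot continuous_q continuous_q).
  exact: (continuous_dot (@continuous_coef_mul i) (@continuous_coef_mul i)).
pose total (G : 'I_d -> bool -> R * V -> R) s := \sum_i \sum_(b : bool)
  iter_int (face i) (fun z => G i b (s, z)) (set_coord 0 i b%:R).
have ctotal G : (forall i b, continuous (G i b)) -> continuous (total G).
  move=> cG; apply: continuous_sumr => i _; apply: continuous_sumr => b _.
  exact: continuous_iter_int_time.
have cI := ctotal _ continuous_influx; have cP := ctotal _ cpos.
have cB := ctotal (fun i _ => bnd i) (fun i _ => cbnd i).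
apply: (@le_trans _ _ (\int[mu]_(s in `]0, t[) total pos s)).
  apply: le_Rintegral => //.
  - exact: (continuous_integrable_oo 0 t cI).
  - exact: (continuous_integrable_oo 0 t cP).
  - move=> s _; apply: ler_sum => i _; apply: ler_sum => b _.
    apply: le_iter_int.
    + exact: (@continuous_slice _ _ _ _ s (@continuous_influx i b)).
    + exact: (@continuous_slice _ _ _ _ s (cpos i b)).
    + by move=> z _; rewrite /pos le_max lexx orbT.
rewrite Rintegral_oo_cc //.
have faces s : s \in `[0, t] ->
    0 <= total pos s <= surface_int Dg (data_flux s) /\
    surface_int Dg (data_flux s) <= total (fun i _ => bnd i) s.
  move=> st.
  have each i (b : bool) := @iter_int_le_bounded _ _ (face i) (set_coord 0 i b%:R)
    (fun z => pos i b (s, z)) (fun z => \1_Dg z * data_flux s z)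
    (fun z => bnd i (s, z)) (@continuous_slice _ _ _ _ s (cbnd i))
    (fun z zb => influx_le_data zb st).
  split; last first.
    by apply: ler_sum => i _; apply: ler_sum => b _; have [] := each i b.
  apply/andP; split.
    apply: sumr_ge0 => i _; apply: sumr_ge0 => b _.
    by have [/andP[]] := each i b.
  apply: ler_sum => i _; apply: ler_sum => b _.
  by have [/andP[]] := each i b.
have := @Rintegral_le_bounded _ _ _ mu `[0, t] (total pos)
  (fun s => surface_int Dg (data_flux s)) (total (fun i _ => bnd i)).
move=> /(_ _ _ _ _)/andP[] //.
- by move=> s /faces[].
- by move=> s /faces[].
- exact: (continuous_integrable_cc 0 t cB).
Qed.

End Energy.

(** * The energy estimate and the error bound *)

Section EnergyEstimate.
Variables (R : realType) (d N : nat).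
Notation V := 'rV[R]_d.
Variables (X : V -> V) (Omega : set V) (J : V -> R) (A : 'I_d -> 'M[R]_N).
Hypothesis hX : smooth_mapping X Omega J.
Hypothesis hJ : bounded_positive J.
Hypothesis hA : forall i, (A i)^T = A i.
Variables (Dg Dr : set V) (I : set R) (q0 : V -> 'cV[R]_N).
Variables (g : V -> R -> 'cV[R]_N) (P : V -> 'M[R]_N) (lam : V -> 'rV[R]_N).
Variables (Rbar : V -> 'M[R]_N) (q : V -> R -> 'cV[R]_N) (t : R).
Hypothesis hsplit : Dg `|` Dr = @cube_boundary R d.
Hypothesis hI : time_interval I.
Hypothesis hP : forall xi, regular_boundary xi ->
  sorted_eigen (normal_mx X A xi) (P xi) (lam xi).
Hypothesis hR : forall xi, Dr xi -> regular_boundary xi ->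
  dissipative_reflection (lam xi) (Rbar xi).
Hypothesis hq : smooth_solution J X A q0 g Dg Dr P lam Rbar I q.
Hypothesis ht : I t.

Lemma iter_box_unit_cube z : iter_box (enum 'I_d) 0 z -> @unit_cube R d z.
Proof.
by move=> zb j; have := zb j; rewrite mem_enum => /andP[z0 z1]; rewrite !ltW.
Qed.

Lemma continuous_solution_slice s : I s ->
  continuous_entries (fun xi => q (clamp_cube xi) s).
Proof.
move=> Is k j; rewrite ord1; have [hC1 _ _ _ _] := hq.
have [cq _ _ _ _] := hC1 k.
apply: (@continuous_comp_within _ _ _ _ _ (fun xi => (clamp_cube xi, s)) cq).
  by apply: continuous_pair; [exact: continuous_clamp_cube|exact: cst_continuous].
by move=> xi; split => //; exact: clamp_cubeP.
Qed.

Lemma continuous_density_slice s : I s ->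
  continuous (fun xi => density J q (clamp_cube xi) s).
Proof.
move=> Is; have cJ := continuous_jacobian_det hX.
have cq := continuous_solution_slice Is; have cqq := continuous_dot cq cq.
by move=> xi; exact: cvgM (cJ xi) (cqq xi).
Qed.

Lemma cube_int_density_clamp s :
  cube_int (fun xi => density J q xi s) =
  cube_int (fun xi => density J q (clamp_cube xi) s).
Proof.
by apply: eq_iter_int => z /iter_box_unit_cube zP; rewrite clamp_cube_id.
Qed.

Lemma cube_int_density_ge0 s : I s -> 0 <= cube_int (fun xi => density J q xi s).
Proof.
move=> Is; rewrite cube_int_density_clamp; apply: iter_int_ge0.
  exact: continuous_density_slice.
move=> z _; rewrite mulr_ge0 ?dot_ge0 // ltW //; apply: (jacobian_det_gt0 hJ).
exact: clamp_cubeP.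
Qed.

Lemma energy_estimate :
  cube_int (fun xi => density J q xi t) <= data_bound J X q0 g Dg P lam t.
Proof.
have [itvI I0 Ige0 _] := hI.
have [hC1 heq hinit hDg hDr] := hq.
have E0 : cube_int (fun xi => density J q xi 0) =
    weighted_norm J (fun xi => q0 (X xi)) ^+ 2.
  have E : cube_int (fun xi => density J q xi 0) =
      cube_int (fun xi => J xi * ((q0 (X xi))^T *m q0 (X xi)) 0 0).
    by apply: eq_iter_int => z /iter_box_unit_cube zP; rewrite /density hinit.
  by rewrite /weighted_norm -E sqr_sqrtr // cube_int_density_ge0.
rewrite /data_bound -E0.
have := Ige0 _ ht; rewrite le_eqVlt => /predU1P[t0|t0].
  rewrite -t0 set_itv1 Rintegral_set1 addr0 //.
apply: (@energy_inequality _ _ _ X Omega J A hX hJ hA I q t t0 _ hC1 heq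
  Dg Dr g P lam Rbar hsplit hP hR hDg hDr).
by move=> s /=; rewrite in_itv /= => /itvI; exact.
Qed.

End EnergyEstimate.

Theorem theorem5p1 (R : realType) (d : nat) (hd : (1 <= d <= 3)%N)
  (J Je : 'rV[R]_d -> R) (hJ : bounded_positive J) (hJe : bounded_positive Je) :
  exists2 C : R, 0 < C &
  forall (Omega Omegae : set 'rV[R]_d) (X Xe : 'rV[R]_d -> 'rV[R]_d)
    (hX : smooth_mapping X Omega J) (hXe : smooth_mapping Xe Omegae Je)
    (N : nat) (A : 'I_d -> 'M[R]_N) (hA : forall i, (A i)^T = A i)
    (Dg Dr : set 'rV[R]_d)
    (hsplit : Dg `|` Dr = @cube_boundary R d) (hDg : borel_set Dg)
    (Iq Iv : set R) (hIq : time_interval Iq) (hIv : time_interval Iv)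
    (q0 : 'rV[R]_d -> 'cV[R]_N)
    (hq0 : C1_bounded_on Omega q0) (hq0e : C1_bounded_on Omegae q0)
    (g : 'rV[R]_d -> R -> 'cV[R]_N)
    (hg : C1_bounded_on ((X @` Dg) `*` Iq) (fun z => g z.1 z.2))
    (hge : C1_bounded_on ((Xe @` Dg) `*` Iv) (fun z => g z.1 z.2))
    (P Pe : 'rV[R]_d -> 'M[R]_N) (lam lame : 'rV[R]_d -> 'rV[R]_N)
    (hP : forall xi, regular_boundary xi ->
      sorted_eigen (normal_mx X A xi) (P xi) (lam xi))
    (hPe : forall xi, regular_boundary xi ->
      sorted_eigen (normal_mx Xe A xi) (Pe xi) (lame xi))
    (Rbar Rbare : 'rV[R]_d -> 'M[R]_N)
    (hR : forall xi, Dr xi -> regular_boundary xi ->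
      dissipative_reflection (lam xi) (Rbar xi))
    (hRe : forall xi, Dr xi -> regular_boundary xi ->
      dissipative_reflection (lame xi) (Rbare xi))
    (q v : 'rV[R]_d -> R -> 'cV[R]_N)
    (hq : smooth_solution J X A q0 g Dg Dr P lam Rbar Iq q)
    (hv : smooth_solution Je Xe A q0 g Dg Dr Pe lame Rbare Iv v)
    (t : R) (htq : Iq t) (htv : Iv t),
  weighted_norm J (fun xi => v xi t - q xi t)
  <= C * (Num.sqrt (data_bound Je Xe q0 g Dg Pe lame t)
          + Num.sqrt (data_bound J X q0 g Dg P lam t)).
Proof.
have [Jmin [Jmax [Jmin0 Jb]]] := hJ; have [Jemin [Jemax [Jemin0 Jeb]]] := hJe.
pose c := 1 + `|Jmax| / Jemin.
have r0 : 0 <= `|Jmax| / Jemin by rewrite divr_ge0 // ltW.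
have c1 : 1 <= c by rewrite /c lerDl.
have c0 : 0 < 2 * c by lra.
exists (Num.sqrt (2 * c)); first by rewrite sqrtr_gt0.
move=> Omega Omegae X Xe hX hXe N A hA Dg Dr hsplit _ Iq Iv hIq hIv q0 _ _ g _ _
  P Pe lam lame hP hPe Rbar Rbare hR hRe q v hq hv t htq htv.
have Eq := energy_estimate hX hJ hA hsplit hIq hP hR hq htq.
have Ev := energy_estimate hXe hJe hA hsplit hIv hPe hRe hv htv.
have Eq0 := le_trans (cube_int_density_ge0 hX hJ hq htq) Eq.
have Ev0 := le_trans (cube_int_density_ge0 hXe hJe hv htv) Ev.
have cq := continuous_density_slice hX hq htq.
have cv := continuous_density_slice hXe hv htv.
set Kq := data_bound J _ _ _ _ _ _ _ in Eq Eq0 *.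
set Kv := data_bound Je _ _ _ _ _ _ _ in Ev Ev0 *.
(* This is where the constant comes from: J <= |Jmax| <= (|Jmax| / Jemin) Je. *)
have comparison xi : unit_cube xi -> J xi <= c * Je xi.
  move=> xiP; have /andP[_ JM] := Jb _ xiP; have /andP[Jem _] := Jeb _ xiP.
  have : `|Jmax| <= `|Jmax| / Jemin * Je xi.
    by rewrite mulrAC ler_pdivlMr // ler_wpM2l.
  have := ler_norm Jmax; rewrite /c; nra.
have main : cube_int (fun xi => J xi * dot (v xi t - q xi t) (v xi t - q xi t))
    <= 2 * c * (Kv + Kq).
  apply: (@le_trans _ _ (2 * c * cube_int (fun xi => density Je v (clamp_cube xi) t)
    + 2 * c * cube_int (fun xi => density J q (clamp_cube xi) t))); last first.
    by rewrite -!cube_int_density_clamp -mulrDr ler_pM2l // lerD.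
  have cvc := continuous_comp_fun cv (@mulrl_continuous R (2 * c)).
  have cqc := continuous_comp_fun cq (@mulrl_continuous R (2 * c)).
  rewrite /cube_int -!iter_intZ // -iter_intD //.
  set L := iter_int _ _ _.
  have -> : L = iter_int (enum 'I_d) (fun xi => J (clamp_cube xi) *
      dot (v (clamp_cube xi) t - q (clamp_cube xi) t)
          (v (clamp_cube xi) t - q (clamp_cube xi) t)) 0.
    by apply: eq_iter_int => z /iter_box_unit_cube zP; rewrite clamp_cube_id.
  apply: le_iter_int.
  - have cJ := continuous_jacobian_det hX.
    have cvq : continuous_entries (fun xi => v (clamp_cube xi) t - q (clamp_cube xi) t).
      have cvt := continuous_solution_slice hv htv.
      have cqt := continuous_solution_slice hq htq.
      move=> k j; under [X in continuous X]eq_fun do rewrite !mxE.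
      by move=> xi; exact: cvgB (cvt k j xi) (cqt k j xi).
    have cd := continuous_dot cvq cvq.
    by move=> xi; exact: cvgM (cJ xi) (cd xi).
  - by move=> xi; exact: cvgD (cvc xi) (cqc xi).
  move=> z _; have zP := clamp_cubeP z; have cmp := comparison _ zP.
  rewrite /density !dotE !mulr_sumr -big_split /=; apply: ler_sum => k _.
  rewrite !mxE.
  have := jacobian_det_gt0 hJ zP; have := jacobian_det_gt0 hJe zP.
  move: (J _) (Je _) (v _ _ _ _) (q _ _ _ _) cmp => j je x y cmp je0 j0.
  have h1 : 0 <= j * (x + y) ^+ 2 by rewrite mulr_ge0 ?sqr_ge0 // ltW.
  have h2 : 0 <= (c * je - j) * x ^+ 2 by rewrite mulr_ge0 ?sqr_ge0 // subr_ge0.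
  have h3 : 0 <= (c - 1) * (j * y ^+ 2).
    by apply: mulr_ge0; [rewrite subr_ge0|rewrite mulr_ge0 ?sqr_ge0 // ltW].
  rewrite -subr_ge0.
  have -> : 2 * c * (je * (x * x)) + 2 * c * (j * (y * y))
      - j * ((x - y) * (x - y)) =
    j * (x + y) ^+ 2 + 2 * ((c * je - j) * x ^+ 2) + 2 * ((c - 1) * (j * y ^+ 2)).
    ring.
  by rewrite !addr_ge0 // mulr_ge0.
rewrite /weighted_norm -/(dot _ _).
apply: (@le_trans _ _ (Num.sqrt (2 * c * (Kv + Kq)))); first exact: ler_wsqrtr.
rewrite (sqrtrM _ (ltW c0)) ler_wpM2l ?sqrtr_ge0 //.
rewrite -[leRHS]ger0_norm ?addr_ge0 ?sqrtr_ge0 // -sqrtr_sqr ler_wsqrtr //.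
rewrite sqrrD !sqr_sqrtr // [leRHS]addrAC lerDl.
by rewrite mulrn_wge0 // mulr_ge0 ?sqrtr_ge0.
Qed.
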